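(* Let $\alpha\in(1,2)$ and let $(X_t)_{t\in\mathbb Z}$ be a real-valued strictly stationary sequence, regularly varying with index $\alpha$, with $\mathbb E[X_0]=0$, satisfying the mixing condition with $p=2$ and the anti-clustering condition (both given in the context). Assume that $\mathbb E[(W^{(2)})^m]<\infty$ for some $m\in\{2,4,\ldots\}$. Then $\mathbb E[R_{\alpha,2}^m]$ is finite and equals $$\frac{(m-1)!}{(m/2-1)!}{\sum}'(k-1)!\,\frac2\alpha\Big(\frac{\alpha/2}{\Gamma(1-\alpha/2)}\Big)^{k}\prod_{j=1}^k\frac{\Gamma((\ell_j+1-\alpha)/2)}{\ell_j!\,\big(1\vee(m-j-\sum_{i=1}^j\ell_i)\big)}\prod_{j=1}^k\mathbb E\big[(W^{(2)})^{\ell_j+1}\big],$$ where ${\sum}'$ denotes summation over all $(k,\ell_1,\ldots,\ell_k)$ with integers $1\le k\le m$, $0\le\ell_1,\ldots,\ell_k\le m$ and $\ell_1+\cdots+\ell_k=m-k$, and $\Gamma$ is the gamma function.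
   Context: A strictly stationary real sequence $(X_t)_{t\in\mathbb Z}$ is regularly varying with index $\alpha$ if there are a Pareto variable $Y_\alpha$ ($\mathbb P(Y_\alpha>x)=x^{-\alpha}$, $x\ge1$) and an independent real sequence $\Theta=(\Theta_t)_{t\in\mathbb Z}$ (the spectral tail process, $|\Theta_0|=1$ a.s.) such that for every $h\ge0$ the conditional law of $x^{-1}(X_{-h},\ldots,X_h)$ given $|X_0|>x$ converges weakly, as $x\to\infty$, to the law of $Y_\alpha(\Theta_{-h},\ldots,\Theta_h)$. Let $(a_n)$ satisfy $n\,\mathbb P(|X_0|>a_n)\to1$; $S_n=\sum_{t=1}^nX_t$, $\gamma_{n,2}=(\sum_{t=1}^nX_t^2)^{1/2}$, $\gamma_{n,\infty}=\max_{1\le t\le n}|X_t|$. Let $r_n\to\infty$ be integers with $k_n=[n/r_n]\to\infty$. Mixing condition with $p=2$: for all $(u,x,\lambda)\in\mathbb R\times\mathbb R_+^2$, as $n\to\infty$, $$\mathbb E\big[e^{i a_n^{-1}uS_n-a_n^{-2}\lambda\gamma_{n,2}^2}\mathbf 1(a_n^{-1}\gamma_{n,\infty}\le x)\big]=\Big(\mathbb E\big[e^{i a_n^{-1}uS_{r_n}-a_n^{-2}\lambda\gamma_{r_n,2}^2}\mathbf 1(a_n^{-1}\gamma_{r_n,\infty}\le x)\big]\Big)^{k_n}+o(1).$$ Anti-clustering condition: $\lim_{l\to\infty}\limsup_{n\to\infty}n\sum_{j=l}^{r_n}\mathbb E[(|a_n^{-1}X_j|\wedge1)(|a_n^{-1}X_0|\wedge1)]=0$.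 For sequences, $\|x\|_q^q=\sum_{t\in\mathbb Z}|x_t|^q$. Under these conditions it is known that $\|\Theta\|_\alpha<\infty$ a.s.; put $Q=\Theta/\|\Theta\|_\alpha$. Then $\mathbb E[(\sum_t|Q_t|)^\alpha]<\infty$, and $a_n^{-1}(S_n,\gamma_{n,2})$ converges in distribution to $(\xi_\alpha,\zeta_{\alpha,2})$, whose law is determined by $$\mathbb E\big[e^{iu\xi_\alpha-\lambda\zeta_{\alpha,2}^2}\big]=\exp\Big(\int_0^\infty\mathbb E\Big[e^{iyu\sum_tQ_t-y^2\lambda\sum_tQ_t^2}-1-iyu\sum_tQ_t\Big]d(-y^{-\alpha})\Big),\quad u\in\mathbb R,\ \lambda\ge0.$$ Set $R_{\alpha,2}=\xi_\alpha/\zeta_{\alpha,2}$, the distributional limit of the studentized sums $S_n/\gamma_{n,2}$. The random sequence $Q^{(2)}$ has law $$\mathbb P(Q^{(2)}\in\cdot)=\mathbb E\Big[\frac{\|Q\|_2^\alpha}{\mathbb E[\|Q\|_2^\alpha]}\mathbf 1\Big(\frac{Q}{\|Q\|_2}\in\cdot\Big)\Big],\qquad W^{(2)}=\sum_{t\in\mathbb Z}Q^{(2)}_t.$$ *)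

(* Defs.v *)
From HB Require Import structures.
From mathcomp Require Import all_boot all_order all_algebra.
From mathcomp Require Import all_classical all_reals all_analysis.
From mathcomp Require Import complex.

Set Implicit Arguments.
Unset Strict Implicit.
Unset Printing Implicit Defensive.

Import Order.TTheory GRing.Theory Num.Theory.
Import numFieldNormedType.Exports.

Local Open Scope classical_set_scope.
Local Open Scope ring_scope.

Section RealSequences.
Context {R : realType}.
Implicit Types (x : int -> R) (p : R).

Definition seq_cylinder : set (set (int -> R)) :=
  [set C | exists (t : int) (B : set R),
             measurable B /\ C = [set x | B (x t)]].

Definition seq_measurable : set (set (int -> R)) := <<s seq_cylinder >>.

(** Unordered two-sided sum; only meaningful for absolutely summable [x]. *)
Definition zsum x : R :=
  fine (\esum_(t in [set: int]) (x^\+ t)%:E)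
  - fine (\esum_(t in [set: int]) (x^\- t)%:E).

(** Takes the dummy value 0 when [x] is not in l^p. *)
Definition lpnorm p x : R :=
  fine (\esum_(t in [set: int]) (`|x t| `^ p)%:E) `^ p^-1.

(** The zero sequence when [lpnorm p x = 0]. *)
Definition lpnormalize p x : int -> R := fun t => x t / lpnorm p x.

Definition window (h : nat) x : 'rV[R]_(h.*2.+1) :=
  \row_(i < h.*2.+1) x (i%:Z - h%:Z).

End RealSequences.

Section Complex.
Context {R : realType}.
Local Open Scope complex_scope.

Definition cexp (z : R[i]) : R[i] :=
  (expR (complex.Re z) * cos (complex.Im z))
  +i* (expR (complex.Re z) * sin (complex.Im z)).

(** Lebesgue integral of a complex-valued function; only meaningful when the
    real and imaginary parts are integrable. *)
Definition cintegral d (T : measurableType d) (mu : {measure set T -> \bar R})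
    (D : set T) (f : T -> R[i]) : R[i] :=
  (\int[mu]_(x in D) complex.Re (f x)) +i* (\int[mu]_(x in D) complex.Im (f x)).

Definition cexpectation d (T : measurableType d) (P : probability T R)
    (f : T -> R[i]) : R[i] := cintegral P setT f.

End Complex.

Section Gamma.
Context {R : realType}.

Definition Gamma_pos (x : R) : R :=
  \int[lebesgue_measure]_(t in `]0, +oo[) (t `^ (x - 1) * expR (- t)).

(** The Gamma function on the real line: for [x <= 0] it is continued by
    Gamma(x) = Gamma(x + n) / (x (x + 1) ... (x + n - 1)), with n the least
    integer such that x + n > 0; the value at the poles is 0. *)
Definition Gamma (x : R) : R :=
  let n := if 0 < x then 0%N else (Num.truncn (- x)).+1 in
  Gamma_pos (x + n%:R) / \prod_(i < n) (x + i%:R).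

End Gamma.

Section Process.
Context {R : realType} {d : measure_display} {T : measurableType d}
  {P : probability T R}.
Variable X : int -> {RV P >-> R}.

Definition strictly_stationary : Prop :=
  forall (h : int) (A : set (int -> R)), seq_measurable A ->
    P [set w | A (fun t => X (t + h) w)] = P [set w | A (fun t => X t w)].

Definition psum (n : nat) (w : T) : R := \sum_(1 <= t < n.+1) X t%:Z w.

Definition gamma2 (n : nat) (w : T) : R :=
  Num.sqrt (\sum_(1 <= t < n.+1) X t%:Z w ^+ 2).

Definition gammaoo (n : nat) (w : T) : R :=
  \big[Num.max/0]_(1 <= t < n.+1) `|X t%:Z w|.

Definition normalizing (a : nat -> R) : Prop :=
  (n%:R%:E * P [set w | (a n < `|X 0 w|)%R])%E @[n --> \oo] --> 1%E.

Definition block_sizes (r : nat -> nat) : Prop :=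
  r n @[n --> \oo] --> \oo /\ (n %/ r n)%N @[n --> \oo] --> \oo.

(** The scaling constant [c] and the number of variables [n] are separate
    arguments: in [mixing] the blocks of length r_n are still scaled by a_n. *)
Definition mixing_transform (c : R) (n : nat) (u x lambda : R) : R[i] :=
  cexpectation P (fun w =>
    cexp (Complex (- (lambda * gamma2 n w ^+ 2 / c ^+ 2)) (u * psum n w / c))
    * real_complex R (\1_[set w' | gammaoo n w' / c <= x] w)).

Definition mixing (a : nat -> R) (r : nat -> nat) : Prop :=
  forall u x lambda : R, 0 <= x -> 0 <= lambda ->
    Normc.normc (mixing_transform (a n) n u x lambda
                 - mixing_transform (a n) (r n) u x lambda ^+ (n %/ r n)%N)
      @[n --> \oo] --> (0 : R).

Definition anti_clustering (a : nat -> R) (r : nat -> nat) : Prop :=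
  limn_esup (fun n => n%:R%:E * \sum_(l <= j < (r n).+1)
    'E_P[fun w => (Num.min `|X j%:Z w / a n| 1
                   * Num.min `|X 0 w / a n| 1)%R])%E
    @[l --> \oo] --> 0%E.

End Process.

Section RegularVariation.
Context {R : realType} {d : measure_display} {T : measurableType d}
  {P : probability T R} {d' : measure_display} {T' : measurableType d'}
  {P' : probability T' R}.

Definition pareto (alpha : R) (Y : {RV P' >-> R}) : Prop :=
  forall x : R, 1 <= x -> P' [set w | x < Y w] = (x `^ (- alpha))%:E.

Definition independent_of_seq (Y : {RV P' >-> R}) (Z : int -> {RV P' >-> R}) :
    Prop :=
  forall (B : set R) (A : set (int -> R)), measurable B -> seq_measurable A ->
    P' [set w | B (Y w) /\ A (Z ^~ w)]
    = (P' [set w | B (Y w)] * P' [set w | A (Z ^~ w)])%E.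

Definition regularly_varying (X : int -> {RV P >-> R}) (alpha : R)
    (Y : {RV P' >-> R}) (Theta : int -> {RV P' >-> R}) : Prop :=
  [/\ pareto alpha Y,
      independent_of_seq Y Theta,
      {ae P', forall w, `|Theta 0 w| = 1} &
      forall (h : nat) (f : 'rV[R]_(h.*2.+1) -> R),
        continuous f -> (exists M : R, forall v, `|f v| <= M) ->
        (\int[P]_(w in [set w | x < `|X 0 w|]) f (x^-1 *: window h (X ^~ w)))
          / fine (P [set w | x < `|X 0 w|]) @[x --> +oo]
        --> \int[P']_w f (Y w *: window h (Theta ^~ w))].

End RegularVariation.

Section Limits.
Context {R : realType} {d : measure_display} {T : measurableType d}
  {P : probability T R} {d' : measure_display} {T' : measurableType d'}
  {P' : probability T' R}.

Definition Qseq (alpha : R) (Theta : int -> {RV P >-> R}) (w : T) : int -> R :=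
  lpnormalize alpha (Theta ^~ w).

(** The law of (xi_alpha, zeta_{alpha,2}), the limit in distribution of
    a_n^{-1} (S_n, gamma_{n,2}); the transform determines the law of
    (xi, zeta^2), hence the one of (xi, zeta) since zeta >= 0. The measure
    d(- y^{-alpha}) is alpha y^{-alpha-1} dy on (0, +oo). *)
Definition limit_law (alpha : R) (Theta : int -> {RV P >-> R})
    (xi zeta : {RV P' >-> R}) : Prop :=
  {ae P', forall w, 0 <= zeta w} /\
  forall u lambda : R, 0 <= lambda ->
    cexpectation P' (fun w =>
      cexp (Complex (- (lambda * zeta w ^+ 2)) (u * xi w)))
    = cexp (cintegral lebesgue_measure `]0, +oo[ (fun y =>
        cexpectation P (fun w =>
          let Q := Qseq alpha Theta w in
          let S := zsum Q in
          let V := zsum (fun t => Q t ^+ 2) in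
          cexp (Complex (- (y ^+ 2 * lambda * V)) (y * u * S))
          - 1 - Complex 0 (y * u * S))
        * real_complex R (alpha * y `^ (- alpha - 1)))).

Definition Q2_law (alpha : R) (Theta : int -> {RV P >-> R})
    (Q2 : int -> {RV P' >-> R}) : Prop :=
  forall A : set (int -> R), seq_measurable A ->
    P' [set w | A (Q2 ^~ w)]
    = 'E_P[fun w =>
        (lpnorm 2 (Qseq alpha Theta w) `^ alpha
         / fine 'E_P[fun w' => (lpnorm 2 (Qseq alpha Theta w') `^ alpha)%R]
         * \1_A (lpnormalize 2 (Qseq alpha Theta w)))%R]%E.

Definition W2 (Q2 : int -> {RV P >-> R}) (w : T) : R := zsum (Q2 ^~ w).

End Limits.

(* Main.v *)
Require Import Defs.
From mathcomp Require Import all_boot all_order all_algebra.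
From mathcomp Require Import all_classical all_reals all_analysis.
From mathcomp Require Import measurable_realfun.
From mathcomp Require Import ring lra zify.

Set Implicit Arguments.
Unset Strict Implicit.
Unset Printing Implicit Defensive.

Import Order.TTheory GRing.Theory Num.Theory.
Import numFieldNormedType.Exports.

Local Open Scope classical_set_scope.
Local Open Scope ring_scope.

(** Write [S = zsum Q], [U = lpnorm 2 Q] and [W = zsum (Q / U)], so that [S = U W]
    and [zsum Q^2 = U^2 <= 1]. The law of [Q2] is the law of [Q / U] under the
    density [U^alpha / c], [c = E U^alpha], hence [E (W2^j) = E (U^alpha W^j) / c].
    The identity [E e^(i u xi - x zeta^2) = exp Psi(u)] is expanded at [u = 0] to
    the order [m]: replacing [e^(i u y S)] by its Taylor polynomial in [Psi] gives a
    polynomial with coefficients [(i u)^j / j! k_j x^((alpha - j) / 2) E (U^alpha W^j)]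
    up to [o(u^m)], with [k_j = (alpha / 2) Gamma ((j - alpha) / 2)], and
    exponentiating it is a linear recursion for the coefficients of the exponential.
    Centered differences of order [m] of [E cos (u xi) e^(- x zeta^2)] are integrals
    of [(2 sin (h xi))^m e^(- x zeta^2)], so Fatou's lemma and dominated convergence
    identify [E xi^m e^(- x zeta^2)] with the coefficient of order [m]. Unrolling the
    recursion yields the sum over [(k, l_1, ..., l_k)], and integrating against
    [x^(m/2 - 1) dx] turns [e^(- x zeta^2)] into [Gamma (m/2) zeta^(-m)]. *)

(** No moment of [xi] is known in advance, so the transform cannot be differentiated under the
    expectation. Only the moment of order [m] of [W] is at hand, so the error in the exponent is
    $o(u^m)$ and not $O(u^{m+1})$. Centered differences of even order respect both limits: they use
    finitely many nodes, annihilate all lower degrees, and their kernel $(\sin(h\xi)/h)^m$ is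
    nonnegative and at most $\xi^m$. Complex numbers are traded for a phase: $\cos(x+\theta)$ with
    $\theta = 0$ and $\theta = -\pi/2$ gives the real and imaginary parts of $e^{ix}$. The
    compensator affects the orders 0 and 1 only, where the argument $(j-\alpha)/2$ of Gamma is
    negative. Order 0 produces the factor $e^{-A x^{\alpha/2}}$ with $A = c\,\Gamma(1-\alpha/2)$. A
    product of [k] coefficients carries $c^k x^{(k\alpha-m)/2}$, and its integral against
    $x^{m/2-1}$ yields $(k-1)!\,(2/\alpha)A^{-k}$; this is the origin of $(k-1)!$, of $2/\alpha$ and
    of the power of $1/\Gamma(1-\alpha/2)$. *)

Section PowerSubstitution.
Context {R : realType}.
Local Notation mu := (@lebesgue_measure R).

(** * Improper integrals under a power substitution *)

Lemma bigcup_itvcy (u : nat -> R) : (forall n, 0 < u n) ->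
  u n @[n --> \oo] --> (0 : R) ->
  \bigcup_n `[u n, +oo[%classic = `]0, +oo[%classic.
Proof.
move=> u0 cu; apply/seteqP; split=> x /=.
  by case=> n _ /=; rewrite !in_itv/= !andbT; exact: lt_le_trans.
rewrite in_itv/= andbT => x0.
have [n _ /(_ n (leqnn n)) h] : \forall n \near \oo, u n < x.
  by apply: (cvgr_lt (0 : R)).
by exists n => //=; rewrite in_itv/= andbT ltW.
Qed.

(** Monotone convergence over growing half-lines; it allows working away from 0, where powers may be
    singular. *)
Lemma cvg_integral_itvcy (u : nat -> R) (f : R -> \bar R) :
  (forall n, 0 < u n) -> {homo u : m n / (m <= n)%N >-> n <= m} ->
  u n @[n --> \oo] --> (0 : R) ->
  measurable_fun `](0:R), +oo[ f -> (forall x : R, 0 < x -> (0 <= f x)%E) ->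
  (\int[mu]_(x in `[u n, +oo[) f x)%E @[n --> \oo] -->
  (\int[mu]_(x in `]0%R, +oo[) f x)%E.
Proof.
move=> u0 du cu mf f0; rewrite -(bigcup_itvcy u0 cu).
apply: ge0_nondecreasing_set_cvg_integral.
- move=> m n mn; rewrite subsetEset; apply: subset_itvr; rewrite bnd_simp.
  exact: du.
- by move=> i; exact: measurable_itv.
- move=> i; apply: measurable_funS mf => // x /=.
  by rewrite !in_itv/= !andbT; exact: lt_le_trans.
- by move=> i x /=; rewrite in_itv/= andbT => /(lt_le_trans (u0 i))/f0.
Qed.

Lemma continuous_powR_gt0 (q x : R) : 0 < x -> {for x, continuous (@powR R ^~ q)}.
Proof.
move=> x0; apply: differentiable_continuous; apply/derivable1_diffP.
by apply: derivable_powR; rewrite in_itv/= x0.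
Qed.

Lemma powR_cvgy (q : R) : 0 < q -> (@powR R ^~ q) x @[x --> +oo] --> +oo.
Proof.
move=> q0; apply/cvgryPge => A.
near=> x.
have x0 : 0 < x by near: x; apply: nbhs_pinfty_gt; rewrite num_real.
have h : (Num.max A 1) `^ q^-1 <= x.
  by near: x; apply: nbhs_pinfty_ge; rewrite num_real.
apply: (@le_trans _ _ (Num.max A 1)); first by rewrite le_max lexx.
have M0 : 0 <= Num.max A 1 by rewrite le_max ler01 orbT.
rewrite -[leLHS](@powRr1 _ (Num.max A 1))// -(mulVf (lt0r_neq0 q0)) powRrM.
by apply: ge0_ler_powR; rewrite ?nnegrE ?powR_ge0 ?ltW.
Unshelve. all: by end_near. Qed.

Lemma cvg_invnS_powR (q : R) : 0 < q -> (n.+1%:R^-1 `^ q : R) @[n --> \oo] --> (0 : R).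
Proof.
move=> q0; have /cvg_at_rightP := powR_cvg0 q0; apply.
by split; [move=> n; rewrite invr_gt0 ltr0n|exact: cvg_harmonic].
Qed.

(** For [q < 1] the derivative of $b x^q$ blows up at 0, so the variable is changed on [[u n, +oo[]
    and [u n] is sent to 0 on both sides. The bound [q <= 1] gives this derivative a finite limit at
    infinity. *)
Lemma ge0_integral_powR_subst (b q : R) (G : R -> R) : 0 < b -> 0 < q <= 1 ->
  {in `]0, +oo[, continuous G} -> (forall x : R, 0 < x -> 0 <= G x) ->
  (\int[mu]_(x in `]0%R, +oo[) (G x)%:E =
   \int[mu]_(x in `]0%R, +oo[) (G (b * x `^ q) * (b * (q * x `^ (q - 1))))%:E)%E.
Proof.
move=> b0 /andP[q0 q1] cG G0.
pose F (x : R) := b * x `^ q.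
have F0 x : 0 < x -> 0 < F x by move=> x0; rewrite mulr_gt0 ?powR_gt0.
have dF (x : R) : 0 < x -> is_derive x 1 F (b * (q * x `^ (q - 1))).
  by move=> x0; have dx := is_derive1_powR q x0; apply: is_deriveZ.
have dFE (x : R) : 0 < x -> derive1 F x = b * (q * x `^ (q - 1)).
  by move=> x0; rewrite derive1E; have [_ ->] := dF x x0.
have cF (x : R) : 0 < x -> {for x, continuous F}.
  by move=> x0; apply: (@cvgM R); [exact: cvg_cst|exact: continuous_powR_gt0].
have cF' (x : R) : 0 < x -> {for x, continuous (derive1 F)}.
  move=> x0.
  have h : b * (q * y `^ (q - 1)) @[y --> x] --> b * (q * x `^ (q - 1)).
    apply: (@cvgM R); first exact: cvg_cst.
    by apply: (@cvgM R); [exact: cvg_cst|exact: continuous_powR_gt0].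
  rewrite /prop_for /continuous_at dFE//; apply: cvg_trans h; apply: near_eq_cvg.
  by near=> y; rewrite dFE//; near: y; exact: lt_nbhsr.
have cont1 : {in `]0, +oo[, continuous (fun x => G (F x) * (b * (q * x `^ (q - 1))))}.
  move=> x; rewrite in_itv/= andbT => x0.
  apply: (@cvgM R).
    apply: (@continuous_comp _ _ _ F G); first exact: cF.
    by apply: cG; rewrite in_itv/= andbT F0.
  apply: (@cvgM R); first exact: cvg_cst.
  by apply: (@cvgM R); [exact: cvg_cst|exact: continuous_powR_gt0].
have mE (H : R -> R) : {in `]0, +oo[, continuous H} ->
    measurable_fun `](0:R), +oo[ (EFin \o H).
  move=> cH; apply/measurable_EFinP; apply: open_continuous_measurable_fun.
    exact: interval_open.
  by move=> x; rewrite inE/=; exact: cH.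
pose u n : R := n.+1%:R^-1.
have u0 n : 0 < u n by rewrite invr_gt0 ltr0n.
have du : {homo u : m n / (m <= n)%N >-> n <= m}.
  by move=> m n mn; rewrite lef_pV2 ?posrE ?ltr0n// ler_nat ltnS.
have cu : u n @[n --> \oo] --> (0 : R) by exact: cvg_harmonic.
have L1 : (\int[mu]_(x in `[F (u n), +oo[) (G x)%:E)%E @[n --> \oo] -->
    (\int[mu]_(x in `]0%R, +oo[) (G x)%:E)%E.
  apply: (@cvg_integral_itvcy (F \o u)).
  - by move=> n; exact: F0.
  - move=> m n mn; rewrite ler_pM2l//.
    by apply: ge0_ler_powR; [exact: ltW|exact: ltW|exact: ltW|exact: du].
  - rewrite -[X in _ --> X](mulr0 b); apply: (@cvgM R); first exact: cvg_cst.
    exact: cvg_invnS_powR.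
  - exact: mE.
  - by move=> x x0; rewrite lee_fin G0.
have L2 : (\int[mu]_(x in `[u n, +oo[) (G (F x) * (b * (q * x `^ (q - 1))))%:E)%E @[n --> \oo] -->
    (\int[mu]_(x in `]0%R, +oo[) (G (F x) * (b * (q * x `^ (q - 1))))%:E)%E.
  apply: cvg_integral_itvcy => //; first exact: mE.
  by move=> x x0; rewrite lee_fin !mulr_ge0 ?powR_ge0 ?G0 ?F0// ltW.
apply: (@cvg_unique _ (@ereal_hausdorff R) _ _ _ _ L1).
rewrite (_ : (fun n => _) = (fun n => \int[mu]_(x in `[u n, +oo[) (G (F x) * (b * (q * x `^ (q - 1))))%:E)%E); last first.
  apply/funext => n.
  rewrite (@increasing_ge0_integration_by_substitutiony R F G (u n)).
  - apply: eq_integral => x; rewrite inE/= in_itv/= andbT => ux.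
    by rewrite -(dFE x (lt_le_trans (u0 n) ux)).
  - move=> x y; rewrite !in_itv/= !andbT => ux uy xy; rewrite ltr_pM2l//.
    by apply: gt0_ltr_powR; rewrite ?nnegrE ?(le_trans (ltW (u0 n))).
  - by move=> x; rewrite in_itv/= andbT => /(lt_trans (u0 n))/cF'.
  - apply/cvg_ex; eexists; apply: cvg_at_right_filter; exact: cF'.
  - have : (b * (q * x `^ (q - 1)) @[x --> +oo] --> ((if q == 1 then b else 0) : R)).
      case: eqP => [->|/eqP qn1].
        apply: (@cvg_trans _ ((fun=> b) x @[x --> +oo])); last exact: cvg_cst.
        by apply: near_eq_cvg; near=> x; rewrite subrr powRr0 !mulr1.
      rewrite -[X in _ --> X](mulr0 b); apply: (@cvgM R); first exact: cvg_cst.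
      rewrite -[X in _ --> X](mulr0 q); apply: (@cvgM R); first exact: cvg_cst.
      have q1' : 0 < 1 - q by rewrite subr_gt0 lt_neqAle qn1 q1.
      apply: (@cvg_trans _ ((x `^ (1 - q))^-1 @[x --> +oo])).
        by apply: near_eq_cvg; near=> x; rewrite -powRN opprB.
      by apply/gtr0_cvgV0; [near=> x; rewrite powR_gt0//; near: x; apply: nbhs_pinfty_gt; rewrite num_real|exact: powR_cvgy].
    move=> h; apply/cvg_ex; eexists; apply: cvg_trans h; apply: near_eq_cvg.
    by near=> x; rewrite dFE//; near: x; apply: nbhs_pinfty_gt; rewrite num_real.
  - split.
      move=> x; rewrite in_itv/= andbT => /(lt_trans (u0 n)) x0.
      by have [] := dF x x0.
    by apply: cvg_at_right_filter; exact: cF.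
  - by apply: gt0_cvgMry => //; exact: powR_cvgy.
  - apply/continuous_within_itvcyP; split.
      by move=> x; rewrite in_itv/= andbT => /(lt_trans (F0 _ (u0 n))) x0; apply: cG; rewrite in_itv/= x0.
    by apply: cvg_at_right_filter; apply: cG; rewrite in_itv/= F0.
  - by move=> x; rewrite in_itv/= andbT => h; apply: G0; rewrite (lt_trans _ h)// F0.
exact: L2.
Unshelve. all: by end_near. Qed.

End PowerSubstitution.

(** * Integrals expressed by the Gamma function *)

Section GammaIntegrals.
Context {R : realType}.
Local Notation mu := (@lebesgue_measure R).

(** Tonelli on the triangle $0 < s < t$. It acts as an integration by parts without boundary
    terms. *)
Lemma ge0_integral_triangle (f g F G : R -> R) :
  measurable_fun [set: R] f -> measurable_fun [set: R] g ->
  (forall x : R, 0 < x -> 0 <= f x) -> (forall x : R, 0 < x -> 0 <= g x) ->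
  (forall t : R, 0 < t -> (\int[mu]_(s in `]0%R, t[) (f s)%:E = (F t)%:E)%E) ->
  (forall s : R, 0 < s -> (\int[mu]_(t in `]s, +oo[) (g t)%:E = (G s)%:E)%E) ->
  (\int[mu]_(t in `]0%R, +oo[) (F t * g t)%:E =
   \int[mu]_(s in `]0%R, +oo[) (f s * G s)%:E)%E.
Proof.
move=> mf mg f0 g0 hF hG.
pose h (z : R * R) : \bar R :=
  (if (0 < z.1) && (z.1 < z.2) then f z.1 * g z.2 else 0)%:E.
have h0 z : (0 <= h z)%E.
  rewrite /h lee_fin; case: ifPn => // /andP[z1 z12].
  by rewrite mulr_ge0 ?f0 ?g0// (lt_trans z1).
have mh : measurable_fun setT h.
  apply/measurable_EFinP; apply: measurable_fun_ifT.
  - by apply: measurable_and; apply: measurable_fun_ltr.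
  - apply: measurable_funM.
    + exact: measurableT_comp.
    + exact: measurableT_comp.
  - exact: measurable_cst.
have := fubini_tonelli h (m1 := mu) (m2 := mu) mh h0.
have -> : (\int[mu]_x \int[mu]_y h (x, y) = \int[mu]_(s in `]0%R, +oo[) (f s * G s)%:E)%E.
  rewrite [RHS]integral_mkcond; apply: eq_integral => s _.
  rewrite patchE; case: ifPn => [|] /=.
    rewrite inE/= in_itv/= andbT => s0.
    rewrite EFinM -(hG _ s0) -ge0_integralZl//; last 3 first.
    - by apply/measurable_EFinP; exact: measurable_funTS.
    - by move=> t /=; rewrite in_itv/= andbT lee_fin => st; rewrite g0// (lt_trans s0).
    - by rewrite lee_fin f0.
    rewrite [RHS]integral_mkcond; apply: eq_integral => t _.
    rewrite patchE/= /h/= s0/=; case: ifPn => st.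
      by rewrite mem_set /= ?in_itv/= ?andbT// EFinM.
    by rewrite memNset//= in_itv/= andbT; apply/negP.
  rewrite notin_setE/= in_itv/= andbT => /negP s0.
  by rewrite integral0_eq// => t _; rewrite /h/= (negbTE s0).
move=> ->; rewrite [LHS]integral_mkcond; apply: eq_integral => t _.
rewrite patchE; case: ifPn => [|] /=.
  rewrite inE/= in_itv/= andbT => t0.
  rewrite EFinM -(hF _ t0) muleC -ge0_integralZl//; last 3 first.
  - by apply/measurable_EFinP; exact: measurable_funTS.
  - by move=> s /=; rewrite in_itv/= => /andP[s0 _]; rewrite lee_fin f0.
  - by rewrite lee_fin g0.
  rewrite [LHS]integral_mkcond; apply: eq_integral => s _.
  rewrite patchE/= /h/=; case: ifPn => st.
    by move: st; rewrite inE/= in_itv/= => ->; rewrite EFinM muleC.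
  by rewrite ifF//; apply/negP => st'; move: st; rewrite notin_setE/= in_itv/= st'.
rewrite notin_setE/= in_itv/= andbT => /negP t0.
rewrite integral0_eq// => s _; rewrite /h/= ifF//.
by apply/negP => /andP[s0 st]; move: t0; rewrite (lt_trans s0).
Qed.

Lemma powRD_gt0 (x r s : R) : 0 < x -> x `^ (r + s) = x `^ r * x `^ s.
Proof. by move=> x0; rewrite powRD// (gt_eqF x0) implybT. Qed.

Lemma measurable_powRM_expR (r : R) (h : R -> R) : measurable_fun [set: R] h ->
  measurable_fun [set: R] (fun x => x `^ r * expR (h x)).
Proof.
move=> mh; apply: measurable_funM; first exact: measurable_powR.
exact: measurableT_comp.
Qed.

Lemma continuous_powRM_expR (r : R) (h : R -> R) : continuous h ->
  {in `]0, +oo[, continuous (fun x => x `^ r * expR (h x))}.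
Proof.
move=> ch x; rewrite in_itv/= andbT => x0.
apply: (@cvgM R); first exact: continuous_powR_gt0.
by apply: (@continuous_comp _ _ _ h expR); [exact: ch|exact: continuous_expR].
Qed.

Local Notation eGamma p :=
  (\int[mu]_(t in `]0%R, +oo[) (t `^ (p - 1) * expR (- t))%:E)%E.

(** Substitution $t = b x^q$. The extended integral is kept because its finiteness is derived later
    from the case [q = 1], [b = 1/2] of this identity. *)
Lemma integral_powR_expR_powR_eGamma (p b q : R) : 0 < b -> 0 < q <= 1 ->
  (\int[mu]_(x in `]0%R, +oo[) (x `^ (q * p - 1) * expR (- (b * x `^ q)))%:E =
   ((q * b `^ p)^-1)%:E * eGamma p)%E.
Proof.
move=> b0 q01; have /andP[q0 q1] := q01.
have k0 : 0 < q * b `^ p by rewrite mulr_gt0 ?powR_gt0.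
rewrite (@ge0_integral_powR_subst R b q (fun t => t `^ (p - 1) * expR (- t)) b0 q01); last 2 first.
- by apply: continuous_powRM_expR => x; exact: cvgN.
- by move=> x x0; rewrite mulr_ge0 ?powR_ge0 ?expR_ge0.
rewrite -ge0_integralZl//=; last 3 first.
- apply/measurable_EFinP; apply: measurable_funTS.
  apply: measurable_funM.
    apply: measurable_funM.
      apply: (measurableT_comp (measurable_powR _)).
      by apply: measurable_funM => //; exact: measurable_powR.
    apply: measurableT_comp => //; apply: measurableT_comp => //.
    by apply: measurable_funM => //; exact: measurable_powR.
  by do 2 (apply: measurable_funM => //); exact: measurable_powR.
- move=> x; rewrite /= in_itv/= andbT => x0; rewrite lee_fin.
  by rewrite !mulr_ge0 ?powR_ge0 ?expR_ge0// ltW.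
- by rewrite lee_fin invr_ge0 ltW.
apply: eq_integral => x; rewrite inE/= in_itv/= andbT => x0.
congr (_%:E); rewrite powRM ?powR_ge0 ?(ltW b0)// -powRrM.
rewrite [X in _ = X](_ : _ = (q * b `^ p)^-1 * q * (b `^ (p - 1) * b) *
  (x `^ (q * (p - 1)) * x `^ (q - 1)) * expR (- (b * x `^ q))); last by ring.
rewrite -{4}(powRr1 (ltW b0)) -powRD_gt0// -powRD_gt0// subrK.
rewrite (_ : q * (p - 1) + (q - 1) = q * p - 1); last by ring.
rewrite -[(_ * _)^-1 * _ * _]mulrA mulVf ?mul1r//; exact: lt0r_neq0.
Qed.

Lemma integral_powR_gauss_eGamma (r v : R) : 0 < v ->
  (\int[mu]_(y in `]0%R, +oo[) (y `^ (r - 1) * expR (- (v * y ^+ 2)))%:E =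
   (v `^ (- (r / 2)) / 2)%:E * eGamma (r / 2))%E.
Proof.
move=> v0; set b := v `^ (- 2^-1).
have b0 : 0 < b by rewrite powR_gt0.
have h01 : 0 < (2^-1 : R) <= 1 by rewrite invr_gt0 ltr0n invf_le1 ?ler1n ?ltr0n.
rewrite (@ge0_integral_powR_subst R b 2^-1 _ b0 h01); last 2 first.
- apply: continuous_powRM_expR => x; apply: cvgN.
  by apply: (@cvgM R); [exact: cvg_cst|exact: exprn_continuous].
- by move=> x x0; rewrite mulr_ge0 ?powR_ge0 ?expR_ge0.
rewrite -ge0_integralZl//=; last 3 first.
- by apply/measurable_EFinP; apply: measurable_funTS; exact: measurable_powRM_expR.
- by move=> x _; rewrite lee_fin mulr_ge0 ?powR_ge0 ?expR_ge0.
- by rewrite lee_fin divr_ge0 ?powR_ge0.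
apply: eq_integral => x; rewrite inE/= in_itv/= andbT => x0.
congr (_%:E).
have -> : v * (b * x `^ 2^-1) ^+ 2 = x.
  rewrite -powR_mulrn ?mulr_ge0 ?powR_ge0// powRM ?powR_ge0// -!powRrM.
  rewrite mulNr mulVf ?powRr1 ?(ltW x0)// powRN powRr1 ?(ltW v0)// mulrA mulfV ?mul1r//.
  exact: lt0r_neq0.
rewrite powRM ?powR_ge0// -!powRrM.
rewrite [LHS](_ : _ = 2^-1 * (v `^ (- 2^-1 * (r - 1)) * b) *
  (x `^ (2^-1 * (r - 1)) * x `^ (2^-1 - 1)) * expR (- x)); last by rewrite /b; ring.
rewrite -!powRD_gt0// mulrA; congr (_ * _ * _); last by congr (_ `^ _); field.
by rewrite mulrC; congr (_ `^ _ / _); field.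
Qed.

(** For [p <= 1] the substitution by $x^p$ reduces the claim to $e^{-t^{1/p}}$, which is at most $e
    \cdot e^{-t}$. Larger [p] descend by unit steps, trading a factor $t$ for half of the
    exponential decay. *)
Lemma eGamma_lty (p : R) : 0 < p -> (eGamma p < +oo)%E.
Proof.
have mexp : measurable_fun [set: R] (fun t : R => expR (- t)).
  by apply: measurableT_comp => //; exact: measurableN.
have int_exp : (\int[mu]_(t in `]0%R, +oo[) (expR (- t))%:E = 1)%E.
  rewrite integral_itv_obnd_cbnd; last first.
    by apply/measurable_EFinP; exact: measurable_funTS.
  rewrite (@ge0_continuous_FTC2y R (fun t => expR (- t)) (fun t => - expR (- t)) 0 0).
  - by rewrite oppr0 expR0 EFinN oppeK add0e.
  - by move=> x _; exact: expR_ge0.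
  - apply: continuous_subspaceT => x.
    by apply: (@continuous_comp _ _ _ -%R expR); [exact: cvgN|exact: continuous_expR].
  - by rewrite -[X in _ --> X]oppr0; apply: cvgN; exact: cvgr_expR.
  - by [].
  - apply: cvg_at_right_filter; apply: cvgN.
    by apply: (@continuous_comp _ _ _ -%R expR); [exact: cvgN|exact: continuous_expR].
  - by move=> x _; rewrite derive1E derive_val; ring.
have step1 : forall p, 0 < p <= 1 -> (eGamma p < +oo)%E.
  move=> {}p p01; have /andP[p0 p1] := p01.
  have p' : 1 <= p^-1 by rewrite invf_ge1.
  have : (\int[mu]_(t in `]0%R, +oo[) (expR (- (t `^ p^-1)))%:E = p%:E * eGamma p)%E.
    rewrite (@ge0_integral_powR_subst R 1 p _ ltr01 p01); last 2 first.
    - move=> x; rewrite in_itv/= andbT => x0.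
      apply: (@continuous_comp _ _ _ (fun t => - (t `^ p^-1)) expR).
        by apply: cvgN; exact: continuous_powR_gt0.
      exact: continuous_expR.
    - by move=> x x0; rewrite expR_ge0.
    rewrite -ge0_integralZl//=; last 3 first.
    - by apply/measurable_EFinP; apply: measurable_funTS; exact: measurable_powRM_expR.
    - by move=> x _; rewrite lee_fin mulr_ge0 ?powR_ge0 ?expR_ge0.
    - by rewrite lee_fin ltW.
    apply: eq_integral => x; rewrite inE/= in_itv/= andbT => x0.
    congr (_%:E); rewrite !mul1r -powRrM mulfV ?powRr1 ?(ltW x0) ?lt0r_neq0//; ring.
  move=> e.
  have : (p%:E * eGamma p < +oo)%E.
    rewrite -e; apply: (@le_lt_trans _ _ (\int[mu]_(t in `]0%R, +oo[) ((expR 1)%:E * (expR (- t))%:E))%E).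
      apply: ge0_le_integral => //=.
      - apply/measurable_EFinP; apply: measurable_funTS.
        by do 2 apply: measurableT_comp => //; exact: measurable_powR.
      - by apply: measurable_funeM; apply/measurable_EFinP; exact: measurable_funTS.
      - move=> x; rewrite in_itv/= andbT => x0.
        rewrite -EFinM lee_fin -expRD ler_expR.
        have [x1|x1] := leP x 1.
          by rewrite (@le_trans _ _ 0)// ?oppr_le0 ?powR_ge0// subr_ge0.
        have : x <= x `^ p^-1 by apply: le1r_powR => //; exact: ltW.
        lra.
    rewrite ge0_integralZl//=.
      by rewrite int_exp mule1 ltry.
    by apply/measurable_EFinP; exact: measurable_funTS.
  by move: (eGamma p) => [r _| |_]; rewrite ?ltry ?ltNyr// gt0_muley ?lte_fin.
suff : forall n : nat, forall p, 0 < p <= n.+1%:R -> (eGamma p < +oo)%E.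
  move=> h p0; apply: (h (Num.truncn p)); rewrite p0/=; exact: ltW (truncnS_gt _).
elim=> [//|n IH] {}p /andP[p0 pn].
have [p1|p1] := leP p 1; first by apply: step1; rewrite p0.
have /IH fin : 0 < p - 1 <= n.+1%:R.
  by rewrite subr_gt0 p1/= lerBlDr -natr1 in pn *.
have e := @integral_powR_expR_powR_eGamma (p - 1) 2^-1 1.
have {}e := e _ _.
(* The bound rests on $t e^{-t/2} \le 2$; the trivial factor 1 and exponent 1 match the substitution
   at [q = 1]. *)
apply: (@le_lt_trans _ _ (\int[mu]_(t in `]0%R, +oo[)
    (2%:E * (t `^ (1 * (p - 1) - 1) * expR (- (2^-1 * t `^ 1)))%:E))%E).
  apply: ge0_le_integral => //=.
  - by move=> x _; rewrite lee_fin mulr_ge0 ?powR_ge0 ?expR_ge0.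
  - by apply/measurable_EFinP; apply: measurable_funTS; exact: measurable_powRM_expR.
  - apply: measurable_funeM; apply/measurable_EFinP; apply: measurable_funTS.
    apply: measurable_powRM_expR; apply: measurableT_comp => //.
    by apply: measurable_funM => //; exact: measurable_powR.
  - move=> x; rewrite in_itv/= andbT => x0.
    rewrite -EFinM lee_fin powRr1 ?(ltW x0)// mul1r.
    rewrite (_ : p - 1 = 1 + (p - 1 - 1)); last by ring.
    rewrite powRD_gt0// powRr1 ?(ltW x0)// (_ : 1 + _ - 1 = p - 1 - 1); last by ring.
    rewrite [x * _]mulrC -mulrA [leRHS]mulrCA; apply: ler_wpM2l; first exact: powR_ge0.
    rewrite (_ : - x = - (2^-1 * x) + - (2^-1 * x)); last by field.
    rewrite expRD mulrA ler_wpM2r ?expR_ge0// expRN ler_pdivrMr ?expR_gt0//.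
    have := expR_ge1Dx (2^-1 * x); lra.
rewrite ge0_integralZl//=; last 2 first.
- apply/measurable_EFinP; apply: measurable_funTS.
  apply: measurable_powRM_expR; apply: measurableT_comp => //.
  by apply: measurable_funM => //; exact: measurable_powR.
- by move=> x _; rewrite lee_fin mulr_ge0 ?powR_ge0 ?expR_ge0.
rewrite e ?ltr01 ?lexx//.
have g0 : (0 <= eGamma (p - 1))%E.
  by apply: integral_ge0 => x _; rewrite lee_fin mulr_ge0 ?powR_ge0 ?expR_ge0.
have /fineK <- : eGamma (p - 1) \is a fin_num by rewrite ge0_fin_numE.
by rewrite -!EFinM ltry.
Qed.

Lemma eGammaE (p : R) : 0 < p -> eGamma p = (Gamma_pos p)%:E.
Proof.
move=> p0; rewrite /Gamma_pos /Rintegral fineK// ge0_fin_numE ?eGamma_lty//.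
by apply: integral_ge0 => x _; rewrite lee_fin mulr_ge0 ?powR_ge0 ?expR_ge0.
Qed.

Lemma integral_powR_expR_powR (p b q : R) : 0 < p -> 0 < b -> 0 < q <= 1 ->
  (\int[mu]_(x in `]0%R, +oo[) (x `^ (q * p - 1) * expR (- (b * x `^ q)))%:E =
   (Gamma_pos p / (q * b `^ p))%:E)%E.
Proof.
move=> p0 b0 q01; rewrite integral_powR_expR_powR_eGamma// eGammaE//.
by rewrite -EFinM mulrC.
Qed.

Lemma integral_powR_gauss (r v : R) : 0 < r -> 0 < v ->
  (\int[mu]_(y in `]0%R, +oo[) (y `^ (r - 1) * expR (- (v * y ^+ 2)))%:E =
   (v `^ (- (r / 2)) / 2 * Gamma_pos (r / 2))%:E)%E.
Proof.
by move=> r0 v0; rewrite integral_powR_gauss_eGamma// eGammaE ?divr_gt0// -EFinM.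
Qed.

Lemma Gamma_pos_gt0 (p : R) : 0 < p -> 0 < Gamma_pos p.
Proof.
move=> p0; rewrite lt_neqAle; apply/andP; split; last first.
  by apply: Rintegral_ge0 => x _; rewrite mulr_ge0 ?powR_ge0 ?expR_ge0.
apply/eqP => G0.
have : (eGamma p = 0)%E by rewrite eGammaE// -G0.
move=> I0.
have mf : measurable_fun `](0:R), +oo[
    (fun t => (t `^ (p - 1) * expR (- t))%:E).
  by apply/measurable_EFinP; apply: measurable_funTS; exact: measurable_powRM_expR.
have : (\int[mu]_(t in `]0%R, +oo[) `|(t `^ (p - 1) * expR (- t))%:E| = 0)%E.
  rewrite -[RHS]I0; apply: eq_integral => x _.
  by rewrite gee0_abs// lee_fin mulr_ge0 ?powR_ge0 ?expR_ge0.
move=> /(ae_eq_integral_abs mu (measurable_itv _) mf)[N [mN N0 NP]].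
have : (mu `]0%R, +oo[%classic <= mu N)%E.
  apply: le_measure; rewrite ?inE//.
  move=> x /= x0; apply: NP => /= /(_ x0) /eqP.
  by rewrite eqe gt_eqF// mulr_gt0 ?expR_gt0 ?powR_gt0//; move: x0; rewrite in_itv/= andbT.
by rewrite N0 lebesgue_measure_itv/= ltry.
Qed.

End GammaIntegrals.

(** * Gamma at integers and the compensated Gaussian integral *)

Section GammaValues.
Context {R : realType}.
Local Notation mu := (@lebesgue_measure R).
Local Notation eGamma p :=
  (\int[mu]_(t in `]0%R, +oo[) (t `^ (p - 1) * expR (- t))%:E)%E.

Lemma integral_itvoo_derive (f F : R -> R) (t : R) : 0 < t ->
  continuous f -> (forall x : R, is_derive x 1 F (f x)) ->
  (\int[mu]_(s in `]0%R, t[) (f s)%:E = (F t - F 0)%:E)%E.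
Proof.
move=> t0 cf dF.
have cF : continuous F.
  by move=> x; apply: differentiable_continuous; apply/derivable1_diffP; case: (dF x).
have mf (A : set R) : measurable_fun A (EFin \o f).
  apply/measurable_EFinP; apply: measurable_funTS; exact: continuous_measurable_fun.
rewrite integral_itv_bndo_bndc ?integral_itv_obnd_cbnd//.
rewrite (@continuous_FTC2 R f F 0 t)//.
- exact: continuous_subspaceT.
- split; [by move=> x _; case: (dF x)| |].
  + by apply: cvg_at_right_filter; exact: cF.
  + by apply: cvg_at_left_filter; exact: cF.
- by move=> x _; rewrite derive1E; case: (dF x).
Qed.

Lemma integral_expRN_itvoy (s : R) :
  (\int[mu]_(t in `]s, +oo[) (expR (- t))%:E = (expR (- s))%:E)%E.
Proof.
rewrite integral_itv_obnd_cbnd; last first.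
  apply/measurable_EFinP; apply: measurable_funTS.
  by apply: measurableT_comp => //; exact: measurableN.
have ce : continuous (fun t : R => expR (- t)).
  by move=> x; apply: (@continuous_comp _ _ _ -%R expR); [exact: cvgN|exact: continuous_expR].
rewrite (@ge0_continuous_FTC2y R (fun t => expR (- t)) (fun t => - expR (- t)) s 0).
- by rewrite EFinN oppeK add0e.
- by move=> x _; exact: expR_ge0.
- exact: continuous_subspaceT.
- by rewrite -[X in _ --> X]oppr0; apply: cvgN; exact: cvgr_expR.
- by [].
- by apply: cvg_at_right_filter; apply: cvgN; exact: ce.
- by move=> x _; rewrite derive1E derive_val; ring.
Qed.

(** The induction step is the integration by parts with $t^{n+1} = \int_0^t (n+1)s^n ds$ and $e^{-s}
    = \int_s^\infty e^{-t} dt$. *)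
Lemma Gamma_posS (n : nat) : Gamma_pos n.+1%:R = n`!%:R :> R.
Proof.
elim: n => [|n IH].
  apply: EFin_inj; rewrite -eGammaE// -[RHS](_ : (expR (- 0))%:E = _); last first.
    by rewrite oppr0 expR0.
  rewrite -integral_expRN_itvoy; apply: eq_integral => x _.
  by rewrite subrr powRr0 mul1r.
apply: EFin_inj; rewrite -eGammaE// factS natrM -{}IH EFinM -eGammaE//.
pose f (s : R) := n.+1%:R * s ^+ n.
have cf : continuous f.
  by move=> x; apply: (@cvgM R); [exact: cvg_cst|exact: exprn_continuous].
have dF (x : R) : is_derive x 1 (fun t : R => t ^+ n.+1) (f x).
  have -> : (fun t : R => t ^+ n.+1) = horner 'X^(n.+1) by apply/funext => t; rewrite hornerXn.
  rewrite (_ : f x = ('X^(n.+1))^`().[x]); first exact: is_derive_poly.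
  by rewrite derivXn hornerMn hornerXn /f mulr_natl.
have m0 : measurable_fun [set: R] (fun t : R => expR (- t)).
  by apply: measurableT_comp => //; exact: measurableN.
have := @ge0_integral_triangle R f (fun t => expR (- t)) (fun t => t ^+ n.+1)
  (fun t => expR (- t)) (continuous_measurable_fun cf) m0.
rewrite -ge0_integralZl//=; last 2 first.
- by apply/measurable_EFinP; apply: measurable_funTS; exact: measurable_powRM_expR.
- by move=> x _; rewrite lee_fin mulr_ge0 ?powR_ge0 ?expR_ge0.
move=> h; rewrite [LHS](_ : _ = \int[mu]_(t in `]0%R, +oo[) (t ^+ n.+1 * expR (- t))%:E)%E.
  rewrite h.
  - apply: eq_integral => x; rewrite inE/= in_itv/= andbT => x0.
    by rewrite -EFinM /f -natr1 addrK powR_mulrn ?mulrA// ltW.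
  - by move=> x x0; rewrite mulr_ge0// exprn_ge0// ltW.
  - by move=> x x0; exact: expR_ge0.
  - move=> t t0; rewrite (integral_itvoo_derive t0 cf dF).
    by rewrite expr0n subr0.
  - by move=> s s0; exact: integral_expRN_itvoy.
apply: eq_integral => x; rewrite inE/= in_itv/= andbT => x0.
by rewrite -natr1 addrK powR_mulrn// ltW.
Qed.

Lemma integral_powR_itvoy (s q : R) : 0 < s -> 0 < q ->
  (\int[mu]_(y in `]s, +oo[) (y `^ (- q - 1))%:E = (s `^ (- q) / q)%:E)%E.
Proof.
move=> s0 q0.
rewrite integral_itv_obnd_cbnd; last first.
  by apply/measurable_EFinP; apply: measurable_funTS; exact: measurable_powR.
rewrite (@ge0_continuous_FTC2y R (fun y => y `^ (- q - 1)) (fun y => - (q^-1 * y `^ (- q))) s 0).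
- by rewrite sub0e EFinN oppeK mulrC.
- by move=> x _; exact: powR_ge0.
- apply/continuous_within_itvcyP; split.
    by move=> x; rewrite in_itv/= andbT => /(lt_trans s0) x0; exact: continuous_powR_gt0.
  by apply: cvg_at_right_filter; exact: continuous_powR_gt0.
- rewrite -[X in _ --> X]oppr0; apply: cvgN.
  rewrite -[X in _ --> X](mulr0 q^-1); apply: (@cvgM R); first exact: cvg_cst.
  apply: (@cvg_trans _ ((x `^ q)^-1 @[x --> +oo])).
    by apply: near_eq_cvg; near=> x; rewrite -powRN.
  by apply/gtr0_cvgV0; [near=> x; rewrite powR_gt0//; near: x; apply: nbhs_pinfty_gt; rewrite num_real|exact: powR_cvgy].
- move=> x /(lt_trans s0) x0.
  by have dx := is_derive1_powR (- q) x0; apply: ex_derive.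
- apply: cvg_at_right_filter; apply: cvgN; apply: (@cvgM R); first exact: cvg_cst.
  exact: continuous_powR_gt0.
- move=> x; rewrite in_itv/= andbT => /(lt_trans s0) x0.
  have dx := is_derive1_powR (- q) x0.
  rewrite derive1E derive_val -[_ *: _]/(_ * _).
  by rewrite mulNr mulrN opprK mulrA mulVf ?mul1r// lt0r_neq0.
Unshelve. all: by end_near. Qed.

(** Writing $1-e^{-vy^2}$ as $\int_0^y 2vs\,e^{-vs^2}ds$ and swapping the integrals leaves a
    Gaussian integral of $s^{1-q}$, convergent at 0 because [q < 2]. *)
Lemma integral_powR_gauss_compensated (q v : R) : 0 < q < 2 -> 0 < v ->
  (\int[mu]_(y in `]0%R, +oo[) (y `^ (- q - 1) * (1 - expR (- (v * y ^+ 2))))%:E =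
   (v `^ (q / 2) / q * Gamma_pos (1 - q / 2))%:E)%E.
Proof.
move=> /andP[q0 q2] v0.
pose f (s : R) := 2 * v * s * expR (- (v * s ^+ 2)).
pose F (s : R) := - expR (- (v * s ^+ 2)).
have dF (x : R) : is_derive x 1 F (f x).
  rewrite /F /f; apply: is_derive_eq.
  rewrite /GRing.scale/=; ring.
have cE : continuous (fun s : R => expR (- (v * s ^+ 2))).
  move=> x.
  apply: (@continuous_comp _ _ _ (fun s : R => - (v * s ^+ 2)) expR); last exact: continuous_expR.
  by apply: cvgN; apply: (@cvgM R); [exact: cvg_cst|exact: exprn_continuous].
have cf : continuous f.
  move=> x; apply: (@cvgM R); last exact: cE.
  by apply: (@cvgM R); [exact: cvg_cst|exact: cvg_id].
rewrite [LHS](_ : _ = \int[mu]_(y in `]0%R, +oo[)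
   ((1 - expR (- (v * y ^+ 2))) * y `^ (- q - 1))%:E)%E; last first.
  by apply: eq_integral => x _; rewrite mulrC.
rewrite (@ge0_integral_triangle R f (fun y => y `^ (- q - 1))
  (fun y => 1 - expR (- (v * y ^+ 2))) (fun s => s `^ (- q) / q)); last first.
- by move=> s s0; exact: integral_powR_itvoy.
- move=> t t0; rewrite (integral_itvoo_derive t0 cf dF).
  by rewrite /F expr0n/= mulr0 oppr0 expR0 opprK addrC.
- by move=> x _; exact: powR_ge0.
- by move=> x x0; rewrite /f !mulr_ge0 ?expR_ge0// ltW.
- exact: measurable_powR.
- exact: continuous_measurable_fun.
rewrite [LHS](_ : _ = \int[mu]_(s in `]0%R, +oo[) ((2 * v / q)%:E *
   (s `^ ((2 - q) - 1) * expR (- (v * s ^+ 2)))%:E))%E; last first.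
  apply: eq_integral => s; rewrite inE/= in_itv/= andbT => s0; rewrite -EFinM; congr _%:E.
  rewrite (_ : 2 - q - 1 = 1 + - q); last by ring.
  by rewrite powRD_gt0// powRr1 ?(ltW s0)// /f; ring.
have k0 : 0 <= 2 * v / q by rewrite divr_ge0 ?mulr_ge0// ltW.
rewrite ge0_integralZl//=; last 2 first.
- apply/measurable_EFinP; apply: measurable_funTS; apply: measurable_powRM_expR.
  apply: measurableT_comp => //; apply: measurable_funM => //.
- by move=> x _; rewrite lee_fin mulr_ge0 ?powR_ge0 ?expR_ge0.
rewrite integral_powR_gauss ?subr_gt0// -EFinM; congr _%:E.
rewrite (_ : - ((2 - q) / 2) = q / 2 - 1); last by field.
rewrite (_ : (2 - q) / 2 = 1 - q / 2); last by field.
rewrite powRD_gt0// powRN powRr1 ?(ltW v0)//; field.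
by rewrite !lt0r_neq0.
Qed.

End GammaValues.

(** * Taylor bounds for cosines with a phase *)

Section CosineTaylor.
Context {R : realType}.
Implicit Types (x u t : R).

Lemma le_norm_sub0 (f df : R -> R) x (B : R) :
  (forall y : R, is_derive y 1 f (df y)) ->
  (forall y : R, `|y| <= `|x| -> `|df y| <= B) -> `|f x - f 0| <= B * `|x|.
Proof.
move=> dff dfB.
have cf : continuous f.
  by move=> y; apply: differentiable_continuous; apply/derivable1_diffP; case: (dff y).
have [x0|/ltW x0] := leP 0 x.
  have [c] := MVT_segment x0 (fun y _ => dff y) (continuous_subspaceT cf).
  rewrite in_itv/= => /andP[c0 cx] ->; rewrite subr0 normrM ler_wpM2r// dfB//.
  by rewrite !ger0_norm.
have [c] := MVT_segment x0 (fun y _ => dff y) (continuous_subspaceT cf).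
rewrite in_itv/= => /andP[xc c0] e.
rewrite -normrN opprB e sub0r normrM normrN ler_wpM2r// dfB//.
by rewrite !ler0_norm// lerN2.
Qed.

(* [cosq theta j] is the [j]-th derivative of [cos (x + theta)] at [x = 0];
   for [theta = 0] and [theta = - pi / 2] these are the real and imaginary
   parts of ['i ^+ j]. *)
Definition cosq (theta : R) (j : nat) : R := cos (theta + j%:R * (pi / 2)).

Lemma cosqS theta j : cosq (theta + pi / 2) j = cosq theta j.+1.
Proof. by rewrite /cosq -natr1; congr cos; ring. Qed.

Lemma cosq_le1 theta j : `|cosq theta j| <= 1.
Proof. exact: cos_max. Qed.

Definition cos_taylor theta n : {poly R} := \poly_(j < n) (cosq theta j / j`!%:R).

Lemma deriv_cos_taylor theta n :
  (cos_taylor theta n.+1)^`() = cos_taylor (theta + pi / 2) n.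
Proof.
apply/polyP => j; rewrite coef_deriv !coef_poly ltnS; case: ifPn; rewrite ?mul0rn// => _.
rewrite cosqS factS natrM -mulr_natr; field.
by rewrite nat1r !pnatr_eq0 -lt0n fact_gt0.
Qed.

(** The derivative of the remainder is the remainder of order one less at phase [theta + pi / 2]. No
    factorial is kept, since only the power of [x] matters. *)
Lemma cos_taylor_le n theta x : `|cos (x + theta) - (cos_taylor theta n).[x]| <= `|x| ^+ n.
Proof.
elim: n theta x => [|n IH] theta x.
  by rewrite /cos_taylor poly_def big_ord0 horner0 subr0 expr0 cos_max.
have /= := @le_norm_sub0 (fun y => cos (y + theta) - (cos_taylor theta n.+1).[y])
  (fun y => cos (y + (theta + pi / 2)) - (cos_taylor (theta + pi / 2) n).[y])
  x (`|x| ^+ n).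
have -> : (cos_taylor theta n.+1).[0] = cos theta.
  rewrite horner_poly big_ord_recl/= big1 ?addr0; last first.
    by move=> i _; rewrite expr0n/= mulr0.
  by rewrite /cosq mul0r addr0 fact0 divr1 mulr1.
rewrite add0r subrr subr0 exprSr; apply.
  move=> y; rewrite -deriv_cos_taylor.
  have d1 : is_derive y 1 (fun y => cos (y + theta)) (cos (y + (theta + pi / 2))).
    by rewrite addrA cosDpihalf; apply: is_derive_eq; rewrite /GRing.scale/=; ring.
  exact: is_deriveB.
by move=> y yx; apply: le_trans (IH _ _) _; rewrite lerXn2r// nnegrE.
Qed.

(** One more Taylor term with the same power of [x]: this weaker bound is the one that an integrable
    moment of order [n] can dominate. *)
Lemma cos_taylorS_le n theta x :
  `|cos (x + theta) - (cos_taylor theta n.+1).[x]| <= 2 * `|x| ^+ n.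
Proof.
have -> : (cos_taylor theta n.+1).[x] =
    (cos_taylor theta n).[x] + cosq theta n / n`!%:R * x ^+ n.
  by rewrite !horner_poly big_ord_recr.
rewrite opprD addrA; apply: le_trans (ler_normB _ _) _.
rewrite mulr_natl mulr2n lerD ?cos_taylor_le//.
rewrite !normrM normrX ler_piMl ?exprn_ge0//.
rewrite normfV normr_nat ler_pdivrMr ?ltr0n ?fact_gt0// mul1r.
by apply: le_trans (cosq_le1 _ _) _; rewrite ler1n fact_gt0.
Qed.

End CosineTaylor.

(** * Centered differences *)

Section CenteredDifference.
Context {R : realType}.
Implicit Types (h x : R) (f : R -> R).

Definition cdiff h f x : R := f (x + h) - f (x - h).

(** The nodes and coefficients do not depend on [h], [f] or [x], so an iterated difference commutes
    with integrals and with limits in [h]. *)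
Lemma iter_cdiffE m : exists s : seq (R * R), forall h f x,
  iter m (cdiff h) f x = \sum_(p <- s) p.1 * f (x + p.2 * h).
Proof.
elim: m => [|m [s hs]].
  by exists [:: (1, 0)] => h f x; rewrite big_seq1 /= mul1r mul0r addr0.
exists ([seq (p.1, p.2 + 1) | p <- s] ++ [seq (- p.1, p.2 - 1) | p <- s]) => h f x.
rewrite iterS /cdiff !hs big_cat !big_map /= -sumrN.
congr (_ + _); apply: eq_bigr => p _ /=; rewrite ?mulNr; do ?congr (- _); congr (_ * f _); ring.
Qed.

Lemma iter_cdiff_sum m h n (a : nat -> R) (f : nat -> R -> R) x :
  iter m (cdiff h) (fun t => \sum_(i < n) a i * f i t) x =
  \sum_(i < n) a i * iter m (cdiff h) (f i) x.
Proof.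
have [s hs] := iter_cdiffE m; rewrite hs.
under [RHS]eq_bigr do rewrite hs mulr_sumr.
rewrite exchange_big/=; apply: eq_bigr => p _; rewrite mulr_sumr.
by apply: eq_bigr => i _; rewrite mulrCA.
Qed.

(** Each difference lowers the degree by one and multiplies the leading coefficient by $2h$ times
    the degree. *)
Lemma iter_cdiff_expr m h j x : (j <= m)%N ->
  iter m (cdiff h) (fun t => t ^+ j) x = if j == m then m`!%:R * (2 * h) ^+ m else 0.
Proof.
elim: m j => [|m IH] j.
  by rewrite leqn0 => /eqP ->; rewrite /= !expr0 fact0 mulr1.
case: j => [_|j jm]; rewrite iterSr.
  have -> : cdiff h (fun t => t ^+ 0) = fun t => \sum_(i < 0) 0 * t ^+ i.
    by apply/funext => t; rewrite /cdiff big_ord0 !expr0 subrr.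
  by rewrite (@iter_cdiff_sum m h 0 (fun=> 0) (fun i t => t ^+ i)) big_ord0.
pose a i : R := (h ^+ i.+1 - (- h) ^+ i.+1) *+ 'C(j.+1, i.+1).
have -> : cdiff h (fun t => t ^+ j.+1) = fun t => \sum_(i < j.+1) a i * t ^+ (j - i).
  apply/funext => t; rewrite /cdiff !exprDn -sumrB big_ord_recl/= !expr0 subrr add0r.
  apply: eq_bigr => i _; rewrite /a /bump /= add1n subSS.
  by rewrite -mulrnBl -mulrBr mulrnAl mulrC.
(* Only the summand [i = 0] keeps degree [j]; the others have degree below [m], so the [m] remaining
   differences annihilate them. *)
rewrite (@iter_cdiff_sum m h j.+1 a (fun i t => t ^+ (j - i))) big_ord_recl /= subn0 big1 ?addr0; last first.
  move=> i _; rewrite /bump/= IH; last by lia.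
  by rewrite ifF ?mulr0//; apply/negbTE; have := ltn_ord i; lia.
rewrite IH// eqSS; case: eqP => [jE|_]; last by rewrite mulr0.
rewrite /a jE !expr1 opprK bin1 factS natrM exprS -mulr_natr; ring.
Qed.

(** By $\cos(a+b)-\cos(a-b) = 2\sin b\,\cos(a+\pi/2)$, each difference contributes a factor
    $2\sin(h\xi)$ and a quarter turn of the phase. *)
Lemma iter_cdiff_cos m h (theta xi x : R) :
  iter m (cdiff h) (fun t => cos (t * xi + theta)) x =
  (2 * sin (h * xi)) ^+ m * cos (x * xi + theta + m%:R * (pi / 2)).
Proof.
elim: m theta x => [|m IH] theta x; first by rewrite expr0 mul1r mul0r addr0.
rewrite iterSr.
have -> : cdiff h (fun t => cos (t * xi + theta)) =
    fun t => \sum_(i < 1) (2 * sin (h * xi)) * cos (t * xi + (theta + pi / 2)).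
  apply/funext => t; rewrite big_ord1 /cdiff.
  rewrite (_ : (t + h) * xi + theta = (t * xi + theta) + h * xi); last by ring.
  rewrite (_ : (t - h) * xi + theta = (t * xi + theta) - h * xi); last by ring.
  by rewrite cosD cosB addrA cosDpihalf; ring.
rewrite (@iter_cdiff_sum m h 1 (fun=> 2 * sin (h * xi))
  (fun=> fun t => cos (t * xi + (theta + pi / 2)))) big_ord1 IH.
by rewrite mulrA exprS -natr1; congr (_ * cos _); ring.
Qed.

End CenteredDifference.

(** * Expansion of the exponential of a polynomial on the imaginary axis *)

Section ExpExpansion.
Context {R : realType}.
Implicit Types (u : R) (p : {poly R}).

Lemma horner_le_exprn p m : (forall i, (i < m)%N -> p`_i = 0) ->
  exists2 C : R, 0 <= C & forall u, `|u| <= 1 -> `|p.[u]| <= C * `|u| ^+ m.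
Proof.
move=> p0; exists (\sum_(i < size p) `|p`_i|); first exact: sumr_ge0.
move=> u u1; rewrite horner_coef; apply: le_trans (ler_norm_sum _ _ _) _.
rewrite mulr_suml; apply: ler_sum => i _; rewrite normrM normrX.
have [im|mi] := ltnP i m; first by rewrite p0// normr0 !mul0r.
by rewrite ler_wpM2l// ler_wiXn2l.
Qed.

(* The recursion for [b] says that [\sum_n b_n z^n] solves [B' = P' B] for
   [P = \sum_j a_j z^j] up to order [m]; taking [z = 'i u], the complex function
   [B e^{-P}] has a derivative of order [u^m]. *)
Lemma expR_poly_cos_expansion (m : nat) (a b : nat -> R) :
  b 0%N = 1 ->
  (forall n, (n < m)%N ->
    n.+1%:R * b n.+1 = \sum_(j < n.+1) j.+1%:R * a j.+1 * b (n - j)%N) ->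
  exists C : R, forall u, `|u| <= 1 ->
  `|expR (\sum_(1 <= j < m.+1) cosq 0 j * a j * u ^+ j) *
      cos (\sum_(1 <= j < m.+1) cosq (- (pi / 2)) j * a j * u ^+ j)
    - \sum_(j < m.+1) cosq 0 j * b j * u ^+ j| <= C * `|u| ^+ m.+1.
Proof.
move=> b0 brec.
pose c := cosq (0 : R); pose s := cosq (- (pi / 2) : R).
have sE j : s j = sin (j%:R * (pi / 2)) by rewrite /s /cosq addrC cosBpihalf.
have cE j : c j = cos (j%:R * (pi / 2)) by rewrite /c /cosq add0r.
have cD i j : c (i + j)%N = c i * c j - s i * s j.
  by rewrite !cE !sE natrD mulrDl cosD.
have sD i j : s (i + j)%N = s i * c j + c i * s j.
  by rewrite !cE !sE natrD mulrDl sinD.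
have c0 : c 0%N = 1 by rewrite cE mul0r cos0.
have s0 : s 0%N = 0 by rewrite sE mul0r sin0.
(* The coefficient of order 0 is dropped; it is an overall factor of the exponential and is restored
   when the transform is assembled. *)
pose P (e : nat -> R) : {poly R} := \poly_(j < m.+1) (if j == 0%N then 0 else e j * a j).
pose B (e : nat -> R) : {poly R} := \poly_(j < m.+1) (e j * b j).
have PE e u : (P e).[u] = \sum_(1 <= j < m.+1) e j * a j * u ^+ j.
  rewrite horner_poly big_ord_recl/= mul0r add0r big_add1/= big_mkord.
  exact: eq_bigr.
have BE e u : (B e).[u] = \sum_(j < m.+1) e j * b j * u ^+ j by rewrite horner_poly.
suff [C hC] : exists C : R, forall u, `|u| <= 1 ->
    `|expR (P c).[u] * cos (P s).[u] - (B c).[u]| <= C * `|u| ^+ m.+1.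
  by exists C => u /hC; rewrite !PE BE.
(* Real and imaginary parts of $B' - P'B$ as functions of [u], after $z = iu$. Below order [m] their
   coefficients vanish by the recursion and the addition formulas for [c] and [s]. *)
pose Ec := (B c)^`() - (P c)^`() * B c + (P s)^`() * B s.
pose Es := (B s)^`() - (P s)^`() * B c - (P c)^`() * B s.
have dPB e e' n : (n < m)%N -> ((P e)^`() * B e')`_n =
    \sum_(j < n.+1) j.+1%:R * a j.+1 * b (n - j)%N * (e j.+1 * e' (n - j)%N).
  move=> nm; rewrite coefM; apply: eq_bigr => j _.
  have jn := ltn_ord j; have j1 : (j.+1 < m.+1)%N by lia.
  have j2 : (n - j < m.+1)%N by lia.
  by rewrite coef_deriv !coef_poly j1 j2/= -mulr_natr; ring.
have dB e n : (n < m)%N -> (B e)^`()`_n = \sum_(j < n.+1) j.+1%:R * a j.+1 * b (n - j)%N * e n.+1.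
  move=> nm; rewrite coef_deriv coef_poly ltnS nm -mulr_natr -mulrA.
  by rewrite [b _ * _]mulrC brec// -mulr_suml mulrC.
have cDj n (j : 'I_n.+1) : c n.+1 = c j.+1 * c (n - j)%N - s j.+1 * s (n - j)%N.
  by rewrite -cD; congr c; have := ltn_ord j; lia.
have sDj n (j : 'I_n.+1) : s n.+1 = s j.+1 * c (n - j)%N + c j.+1 * s (n - j)%N.
  by rewrite -sD; congr s; have := ltn_ord j; lia.
have Ec0 n : (n < m)%N -> Ec`_n = 0.
  move=> nm; rewrite /Ec coefD coefB dB// !dPB// -sumrB -big_split/= big1// => j _.
  by rewrite (cDj n j); ring.
have Es0 n : (n < m)%N -> Es`_n = 0.
  move=> nm; rewrite /Es !coefB dB// !dPB// -!sumrB big1// => j _.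
  by rewrite (sDj n j); ring.
have [C1 C10 hC1] := horner_le_exprn Ec0.
have [C2 C20 hC2] := horner_le_exprn Es0.
have [C3 C30 hC3] : exists2 C : R, 0 <= C & forall u, `|u| <= 1 -> `|(P c).[u]| <= C.
  have [//|C C0 h] := @horner_le_exprn (P c) 0.
  by exists C => // u /h; rewrite expr0 mulr1.
(* Real and imaginary parts of $B e^{-P}$. *)
pose Nc u := expR (- (P c).[u]) * ((B c).[u] * cos (P s).[u] + (B s).[u] * sin (P s).[u]).
pose Ns u := expR (- (P c).[u]) * ((B s).[u] * cos (P s).[u] - (B c).[u] * sin (P s).[u]).
have dN u : is_derive u 1 Nc (expR (- (P c).[u]) * (Ec.[u] * cos (P s).[u] + Es.[u] * sin (P s).[u]))
   /\ is_derive u 1 Ns (expR (- (P c).[u]) * (Es.[u] * cos (P s).[u] - Ec.[u] * sin (P s).[u])).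
  have dcos : is_derive u 1 (fun u => cos (P s).[u]) (- sin (P s).[u] * (P s)^`().[u]).
    by apply: is_derive_eq; rewrite /GRing.scale/=; ring.
  have dsin : is_derive u 1 (fun u => sin (P s).[u]) (cos (P s).[u] * (P s)^`().[u]).
    by apply: is_derive_eq; rewrite /GRing.scale/=; ring.
  have dexp : is_derive u 1 (fun u => expR (- (P c).[u])) (- (P c)^`().[u] * expR (- (P c).[u])).
    by apply: is_derive_eq; rewrite /GRing.scale/=; ring.
  by split; (apply: is_derive_eq; rewrite /Ec /Es !hornerE /GRing.scale/=; ring).
have bnd u : `|u| <= 1 -> `|Nc u - 1| <= expR C3 * (C1 + C2) * `|u| ^+ m * `|u| /\
    `|Ns u| <= expR C3 * (C1 + C2) * `|u| ^+ m * `|u|.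
  move=> u1.
  have Nc0 : Nc 0 = 1.
    rewrite /Nc !PE !BE !big_ord_recl !big_add1/= !big_mkord !expr0 !mulr1.
    rewrite !big1 ?addr0; try by move=> i _; rewrite expr0n/= mulr0.
    by rewrite c0 s0 b0 oppr0 expR0 cos0 sin0; ring.
  have Ns0 : Ns 0 = 0.
    rewrite /Ns !PE !BE !big_ord_recl !big_add1/= !big_mkord !expr0 !mulr1.
    rewrite !big1 ?addr0; try by move=> i _; rewrite expr0n/= mulr0.
    by rewrite c0 s0 b0 oppr0 expR0 cos0 sin0; ring.
  have key (y z : R) : `|y| <= `|u| -> `|z| <= C1 * `|y| ^+ m + C2 * `|y| ^+ m ->
      `|expR (- (P c).[y]) * z| <= expR C3 * (C1 + C2) * `|u| ^+ m.
    move=> yu hz; rewrite normrM ger0_norm ?expR_ge0// -mulrA.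
    apply: ler_pM => //.
      rewrite ler_expR; apply: le_trans (hC3 y (le_trans yu u1)).
      by rewrite -normrN ler_norm.
    apply: le_trans hz _; rewrite -mulrDl ler_wpM2l ?addr_ge0//.
    by rewrite lerXn2r// nnegrE.
  have tri (y e1 e2 t1 t2 : R) : `|y| <= `|u| -> `|e1| <= C1 * `|y| ^+ m -> `|e2| <= C2 * `|y| ^+ m ->
      `|t1| <= 1 -> `|t2| <= 1 -> `|e1 * t1 + e2 * t2| <= C1 * `|y| ^+ m + C2 * `|y| ^+ m.
    move=> yu h1 h2 h3 h4; apply: le_trans (ler_normD _ _) _.
    by rewrite !normrM lerD// -[leRHS]mulr1 ler_pM.
  rewrite -{1}Nc0 -[Ns u]subr0 -{2}Ns0; split.
    apply: (le_norm_sub0 (fun y => (dN y).1)) => y yu; apply: key => //.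
    by apply: tri => //; rewrite ?cos_max ?sin_max ?hC1 ?hC2// (le_trans yu).
  apply: (le_norm_sub0 (fun y => (dN y).2)) => y yu; apply: key => //.
  rewrite addrC -mulNr; apply: tri => //; rewrite ?normrN ?cos_max ?sin_max ?hC1 ?hC2// (le_trans yu)//.
exists (expR C3 * (2 * (expR C3 * (C1 + C2)))) => u u1.
have [b1 b2] := bnd u u1.
(* Multiplying back by $e^P$, the error is the real part of $e^P(1 - B e^{-P})$, and $B e^{-P} - 1$
   is $O(u^{m+1})$ by the mean value bound. *)
have e1 : expR (P c).[u] * (Nc u * cos (P s).[u] - Ns u * sin (P s).[u]) = (B c).[u].
  rewrite /Nc /Ns expRN.
  rewrite (_ : _ - _ = (expR (P c).[u])^-1 * ((B c).[u] * (cos (P s).[u] ^+ 2 + sin (P s).[u] ^+ 2))); last by ring.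
  by rewrite cos2Dsin2 mulr1 mulrA mulfV ?mul1r// gt_eqF// expR_gt0.
rewrite -e1 -mulrBr normrM -mulrA ger0_norm ?expR_ge0//.
apply: ler_pM; rewrite ?expR_ge0//.
  by rewrite ler_expR (le_trans (ler_norm _)) ?hC3.
rewrite (_ : _ - _ = - ((Nc u - 1) * cos (P s).[u]) + Ns u * sin (P s).[u]); last by ring.
apply: le_trans (ler_normD _ _) _; rewrite normrN [`|_ * cos _|]normrM [`|Ns u * _|]normrM exprSr.
rewrite (_ : 2 * _ * _ = expR C3 * (C1 + C2) * `|u| ^+ m * `|u| + expR C3 * (C1 + C2) * `|u| ^+ m * `|u|); last by ring.
by apply: lerD; rewrite -[leRHS]mulr1 ler_pM ?cos_max ?sin_max.
Qed.

End ExpExpansion.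

(** * Moments of the compensated Gaussian kernel *)

Section CompensatedMoments.
Context {R : realType}.
Local Notation mu := (@lebesgue_measure R).

Lemma Gamma_gt0E (x : R) : 0 < x -> Gamma x = Gamma_pos x.
Proof. by move=> x0; rewrite /Gamma x0 big_ord0 divr1 addr0. Qed.

Lemma Gamma_itvN10 (x : R) : -1 < x < 0 -> Gamma x = Gamma_pos (x + 1) / x.
Proof.
move=> /andP[x1 x0]; rewrite /Gamma ltNge (ltW x0)/=.
have -> : Num.truncn (- x) = 0%N by apply/truncn0Pn; rewrite -ltNge; lra.
by rewrite big_ord1 addr0.
Qed.

(* [comp_exp j lambda z] is [e^{- lambda z^2}] minus the compensating term, for
   the [j]-th Taylor coefficient in [u] of [e^{i u z - lambda z^2} - 1 - i u z]. *)
Definition comp_exp (lambda : R) (j : nat) (z : R) : R :=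
  expR (- (lambda * z ^+ 2)) - (j <= 1)%:R.

(** The sign of [comp_exp]: it makes the integrands nonnegative, so that integrals can be handled
    before integrability is established. *)
Definition comp_sign (j : nat) : R := if (j <= 1)%N then -1 else 1.

(** The integral of $z^j$ times [comp_exp] against $d(-z^{-\alpha})$. For $j \le 1$ and $1 < \alpha
    < 2$ the argument of [Gamma] lies in $(-1,0)$: the compensation produces the analytic
    continuation. *)
Definition comp_moment (alpha lambda : R) (j : nat) : R :=
  alpha / 2 * Gamma ((j%:R - alpha) / 2) * lambda `^ ((alpha - j%:R) / 2).

Lemma comp_signK j (x : R) : comp_sign j * (comp_sign j * x) = x.
Proof. by rewrite /comp_sign; case: ifP => _; rewrite ?mul1r// !mulN1r opprK. Qed.

Lemma comp_exp_sign lambda j z : 0 <= lambda ->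
  0 <= comp_sign j * comp_exp lambda j z.
Proof.
move=> l0; rewrite /comp_sign /comp_exp; case: leqP => _.
  by rewrite mulN1r opprB subr_ge0 -expR0 ler_expR oppr_le0 mulr_ge0// sqr_ge0.
by rewrite mul1r subr0 expR_ge0.
Qed.

Lemma measurable_comp_exp lambda j : measurable_fun [set: R] (comp_exp lambda j).
Proof.
apply: measurable_funB => //; apply: measurableT_comp => //.
by apply: measurableT_comp => //; apply: measurable_funM => //; exact: exprn_measurable.
Qed.

(** For $j \ge 2$ this is a plain Gaussian integral; for $j \le 1$ it is the compensated one with $q
    = \alpha - j$, rewritten by $\Gamma(-q/2) = -(2/q)\,\Gamma(1-q/2)$. *)
Lemma integral_comp_exp (alpha lambda : R) (j : nat) : 1 < alpha < 2 -> 0 < lambda ->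
  (\int[mu]_(y in `]0%R, +oo[)
     (alpha * y `^ (- alpha - 1) * (y ^+ j * (comp_sign j * comp_exp lambda j y)))%:E =
   (comp_sign j * comp_moment alpha lambda j)%:E)%E.
Proof.
move=> /andP[a1 a2] l0; have a0 : 0 < alpha by lra.
have powE y : 0 < y -> y `^ (- alpha - 1) * y ^+ j = y `^ (j%:R - alpha - 1).
  move=> y0; rewrite -powR_mulrn ?(ltW y0)// -powRD_gt0//; congr (_ `^ _); ring.
rewrite /comp_sign /comp_moment; case: leqP => j1.
- pose q : R := alpha - j%:R.
  have q0 : 0 < q < 2.
    by rewrite /q; case: (j) j1 => [|[|//]] _ /=; rewrite ?subr0; apply/andP; split; lra.
  have /andP[q00 q2] := q0.
  rewrite [LHS](_ : _ = \int[mu]_(y in `]0%R, +oo[)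
    (alpha%:E * (y `^ (- q - 1) * (1 - expR (- (lambda * y ^+ 2))))%:E))%E; last first.
    apply: eq_integral => y; rewrite inE/= in_itv/= andbT => y0.
    rewrite -EFinM /comp_exp j1 mulN1r opprB -mulrA [_ `^ _ * (_ * _)]mulrA powE//.
    by congr (_ * (_ `^ _ * _))%:E; rewrite /q; ring.
  rewrite ge0_integralZl//=; last 3 first.
  + apply/measurable_EFinP; apply: measurable_funTS; apply: measurable_funM.
      exact: measurable_powR.
    apply: measurable_funB => //; apply: measurableT_comp => //; apply: measurableT_comp => //.
    by apply: measurable_funM => //; exact: exprn_measurable.
  + move=> y _; rewrite lee_fin mulr_ge0 ?powR_ge0// subr_ge0 -expR0 ler_expR oppr_le0.
    by rewrite mulr_ge0 ?sqr_ge0// ltW.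
  + by rewrite lee_fin ltW.
  rewrite integral_powR_gauss_compensated// -EFinM; congr _%:E.
  rewrite Gamma_itvN10; last by rewrite -/q (_ : _ / 2 = - (q / 2)); [apply/andP; split|rewrite /q]; lra.
  rewrite -/q (_ : (j%:R - alpha) / 2 + 1 = 1 - q / 2); last by rewrite /q; field.
  rewrite (_ : (j%:R - alpha) / 2 = - (q / 2)); last by rewrite /q; field.
  by field; rewrite lt0r_neq0.
- have r0 : 0 < j%:R - alpha.
    by rewrite subr_gt0 (lt_le_trans a2)// (ler_nat R 2 j).
  rewrite [LHS](_ : _ = \int[mu]_(y in `]0%R, +oo[)
    (alpha%:E * (y `^ ((j%:R - alpha) - 1) * expR (- (lambda * y ^+ 2)))%:E))%E; last first.
    apply: eq_integral => y; rewrite inE/= in_itv/= andbT => y0.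
    by rewrite -EFinM /comp_exp leqNgt j1/= subr0 mul1r -mulrA [_ `^ _ * (_ * _)]mulrA powE.
  rewrite ge0_integralZl//=; last 3 first.
  + apply/measurable_EFinP; apply: measurable_funTS; apply: measurable_powRM_expR.
    by apply: measurableT_comp => //; apply: measurable_funM => //; exact: exprn_measurable.
  + by move=> y _; rewrite lee_fin mulr_ge0 ?powR_ge0 ?expR_ge0.
  + by rewrite lee_fin ltW.
  rewrite integral_powR_gauss// -EFinM; congr _%:E.
  rewrite Gamma_gt0E ?divr_gt0// (_ : - ((j%:R - alpha) / 2) = (alpha - j%:R) / 2); last by field.
  by field.
Qed.

(** Scaling [y] by [U] amounts to replacing [lambda] by [lambda * U ^+ 2] and factoring out
    [U ^+ j]; the powers of [U] combine to $U^\alpha$. *)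
Lemma integral_comp_expM (alpha lambda U : R) (j : nat) :
  1 < alpha < 2 -> 0 < lambda -> 0 <= U ->
  (\int[mu]_(y in `]0%R, +oo[)
     (alpha * y `^ (- alpha - 1) * ((y * U) ^+ j * (comp_sign j * comp_exp lambda j (y * U))))%:E =
   (U `^ alpha * (comp_sign j * comp_moment alpha lambda j))%:E)%E.
Proof.
move=> a12 l0; have /andP[a1 a2] := a12; have a0 : 0 < alpha by lra.
(* At [U = 0] both sides vanish: for [j = 0] because [comp_exp] is 0 at 0, otherwise because of the
   factor $0^j$. *)
rewrite le_eqVlt => /predU1P[<-|U0].
  rewrite powR0 ?lt0r_neq0// mul0r integral0_eq// => y _; rewrite mulr0 /comp_exp.
  rewrite [0 ^+ 2]expr0n mulr0 oppr0 expR0.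
  by case: j => [|j]; rewrite ?subrr ?[0 ^+ j.+1]expr0n ?mul0r ?mulr0.
have V0 : 0 < lambda * U ^+ 2 by rewrite mulr_gt0 ?exprn_gt0.
rewrite [LHS](_ : _ = \int[mu]_(y in `]0%R, +oo[) ((U ^+ j)%:E *
   (alpha * y `^ (- alpha - 1) * (y ^+ j * (comp_sign j * comp_exp (lambda * U ^+ 2) j y)))%:E))%E; last first.
  apply: eq_integral => y _; rewrite -EFinM /comp_exp !exprMn.
  rewrite (_ : lambda * (y ^+ 2 * U ^+ 2) = lambda * U ^+ 2 * y ^+ 2); last by ring.
  by congr _%:E; ring.
rewrite ge0_integralZl//=; last 3 first.
- apply/measurable_EFinP; apply: measurable_funTS; apply: measurable_funM.
    by apply: measurable_funM => //; exact: measurable_powR.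
  apply: measurable_funM; first exact: exprn_measurable.
  by apply: measurable_funM => //; exact: measurable_comp_exp.
- move=> y; rewrite in_itv/= andbT => y0; rewrite lee_fin.
  apply: mulr_ge0; first by rewrite mulr_ge0 ?powR_ge0// ltW.
  by rewrite mulr_ge0 ?exprn_ge0 ?comp_exp_sign ?ltW.
- by rewrite lee_fin exprn_ge0// ltW.
rewrite integral_comp_exp// -EFinM; congr _%:E.
rewrite /comp_moment powRM ?(ltW l0) ?exprn_ge0 ?(ltW U0)//.
rewrite -[U ^+ 2]powR_mulrn ?(ltW U0)// -powRrM (_ : 2%:R * _ = alpha - j%:R); last by field.
rewrite (_ : U `^ alpha = U ^+ j * U `^ (alpha - j%:R)); first by ring.
by rewrite -powR_mulrn ?(ltW U0)// -powRD_gt0//; congr (_ `^ _); ring.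
Qed.

End CompensatedMoments.

(** * Expansion at the origin of the exponent of the limit law *)

Section TailExpansion.
Context {R : realType} {d : measure_display} {T : measurableType d}
  (P : probability T R).
Local Notation mu := (@lebesgue_measure R).
Local Notation muP := (mu \x P)%E.
Variables (U W : T -> R) (alpha lambda : R) (m : nat).
Hypothesis mU : measurable_fun [set: T] U.
Hypothesis mW : measurable_fun [set: T] W.
Hypothesis U01 : forall w, 0 <= U w <= 1.
Hypothesis alpha12 : 1 < alpha < 2.
Hypothesis lambda0 : 0 < lambda.
Hypothesis m_gt1 : (1 < m)%N.
Hypothesis iWm : P.-integrable setT (fun w => (U w `^ alpha * `|W w| ^+ m)%:E).

Let alpha_gt0 : 0 < alpha. Proof. by move: alpha12 => /andP[]; lra. Qed.

Let U_ge0 w : 0 <= U w. Proof. by have /andP[] := U01 w. Qed.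

Let Ua_le1 w : U w `^ alpha <= 1.
Proof.
have -> : 1 = 1 `^ alpha :> R by rewrite powR1.
by apply: ge0_ler_powR; rewrite ?nnegrE ?(ltW alpha_gt0)//; have /andP[] := U01 w.
Qed.

Let Ua_ge0 w : 0 <= U w `^ alpha. Proof. exact: powR_ge0. Qed.

Let pow_le1D (x : R) j : (j <= m)%N -> 0 <= x -> x ^+ j <= 1 + x ^+ m.
Proof.
move=> jm x0; have [x1|/ltW x1] := leP x 1.
  by rewrite (@le_trans _ _ 1) ?exprn_ile1// lerDl exprn_ge0.
by rewrite (@le_trans _ _ (x ^+ m)) ?ler_weXn2l// lerDr.
Qed.

Let mUa : measurable_fun [set: T] (fun w => U w `^ alpha).
Proof. exact: (measurableT_comp (measurable_powR _)). Qed.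

Let iWm1 : P.-integrable setT (fun w => (1 + U w `^ alpha * `|W w| ^+ m)%:E).
Proof.
under eq_fun do rewrite EFinD.
by apply: integrableD => //; exact: finite_measure_integrable_cst.
Qed.

Lemma integrable_powR_moment j : (j <= m)%N ->
  P.-integrable setT (fun w => (U w `^ alpha * W w ^+ j)%:E).
Proof.
move=> jm; apply: (le_integrable _ _ _ iWm1) => //.
  apply/measurable_EFinP; apply: measurable_funM => //.
  exact: (measurableT_comp (exprn_measurable _)).
move=> w _; rewrite /= lee_fin normrM (ger0_norm (Ua_ge0 w)) normrX.
apply: le_trans (ler_norm _).
apply: (@le_trans _ _ (U w `^ alpha * (1 + `|W w| ^+ m))).
  by rewrite ler_wpM2l// pow_le1D.
by rewrite mulrDr mulr1 lerD2r.
Qed.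

(** $(U|W|)^m \le U^\alpha |W|^m$, since $U \le 1$ and $\alpha < 2 \le m$. *)
Lemma integrable_UW : P.-integrable setT (fun w => (U w * W w)%:E).
Proof.
apply: (le_integrable _ _ _ iWm1) => //.
  by apply/measurable_EFinP; exact: measurable_funM.
move=> w _; rewrite /= lee_fin normrM (ger0_norm (U_ge0 w)).
apply: le_trans (ler_norm _).
apply: (@le_trans _ _ (1 + (U w * `|W w|) ^+ m)).
  by rewrite -[leLHS]expr1; apply: pow_le1D; rewrite ?(ltnW m_gt1)// mulr_ge0.
rewrite lerD2l exprMn ler_wpM2r ?exprn_ge0//.
rewrite -powR_mulrn//.
have /andP[a1 a2] := alpha12.
have am : alpha <= m%:R by rewrite (le_trans (ltW a2))// (ler_nat R 2 m).
have [u0|u0] := leP (U w) 0.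
  have -> : U w = 0 by apply/eqP; rewrite eq_le u0 U_ge0.
  by rewrite !powR0// ?lt0r_neq0// ltr0n (ltn_trans _ m_gt1).
by apply: ger_powR => //; rewrite u0/=; have /andP[] := U01 w.
Qed.

(** Density of $d(-y^{-\alpha})$ extended by 0, so that Fubini applies on the full product with
    [P]. *)
Let dens (y : R) : R := alpha * y `^ (- alpha - 1) * \1_(`]0, +oo[%classic) y.

Let dens_ge0 y : 0 <= dens y.
Proof. by rewrite /dens !mulr_ge0 ?powR_ge0// ltW. Qed.

Let mdens : measurable_fun [set: R] dens.
Proof.
apply: measurable_funM; last exact: measurable_indic.
by apply: measurable_funM => //; exact: measurable_powR.
Qed.

Let integral_dens (g : R -> R) :
  (\int[mu]_y (dens y * g y)%:E =
   \int[mu]_(y in `]0%R, +oo[) (alpha * y `^ (- alpha - 1) * g y)%:E)%E.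
Proof.
rewrite [RHS]integral_mkcond; apply: eq_integral => y _; rewrite patchE /dens indicE.
by case: ifPn => yD; rewrite ?(negbTE yD) ?mulr1// mulr0 mul0r.
Qed.

(** The [j]-th Taylor coefficient in [u] of the compensated integrand, up to the scalar $i^j/j!$. *)
Let h j (z : R * T) : R :=
  dens z.1 * ((z.1 * U z.2) ^+ j * W z.2 ^+ j * comp_exp lambda j (z.1 * U z.2)).

Let mU2 : measurable_fun [set: R * T] (fun z => z.1 * U z.2).
Proof. by apply: measurable_funM => //; exact: measurableT_comp. Qed.

Let mW2 : measurable_fun [set: R * T] (fun z => W z.2).
Proof. exact: measurableT_comp. Qed.

Let mdens2 : measurable_fun [set: R * T] (fun z => dens z.1).
Proof. exact: measurableT_comp. Qed.

Let mh j : measurable_fun [set: R * T] (h j).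
Proof.
apply: measurable_funM => //; apply: measurable_funM.
  by apply: measurable_funM; apply: (measurableT_comp (exprn_measurable _)).
exact: (measurableT_comp (measurable_comp_exp _ _)).
Qed.

Let g j w (y : R) : R :=
  dens y * ((y * U w) ^+ j * (comp_sign j * comp_exp lambda j (y * U w))).

Let hE j y w : h j (y, w) = W w ^+ j * comp_sign j * g j w y.
Proof.
rewrite /h /g /=; rewrite -{1}[comp_exp _ _ _](comp_signK j); ring.
Qed.

Let g_ge0 j w y : 0 <= g j w y.
Proof.
rewrite /g /dens indicE; case: (boolP (y \in _)) => [|_]; last by rewrite mulr0 mul0r.
rewrite inE/= in_itv/= andbT => y0; rewrite mulr1.
apply: mulr_ge0; first by rewrite mulr_ge0 ?powR_ge0// ltW.
by rewrite mulr_ge0 ?comp_exp_sign ?exprn_ge0 ?mulr_ge0// ltW.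
Qed.

Let mg j w : measurable_fun [set: R] (g j w).
Proof.
apply: measurable_funM => //; apply: measurable_funM.
  by apply: (measurableT_comp (exprn_measurable _)); exact: measurable_funM.
apply: measurable_funM => //; apply: (measurableT_comp (measurable_comp_exp _ _)).
exact: measurable_funM.
Qed.

Let integral_g j w : (\int[mu]_y (g j w y)%:E =
  (U w `^ alpha * (comp_sign j * comp_moment alpha lambda j))%:E)%E.
Proof. by rewrite integral_dens integral_comp_expM. Qed.

Let integrable_g j w : mu.-integrable setT (fun y => (g j w y)%:E).
Proof.
apply/integrableP; split; first by apply/measurable_EFinP; exact: mg.
rewrite (_ : (\int[mu]_x _)%E = (\int[mu]_y (g j w y)%:E)%E); last first.
  by apply: eq_integral => y _; rewrite gee0_abs// lee_fin.
by rewrite integral_g ltry.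
Qed.

Let integral_h1 j w : (\int[mu]_y (h j (y, w))%:E =
  (comp_moment alpha lambda j * (U w `^ alpha * W w ^+ j))%:E)%E.
Proof.
under eq_integral do rewrite hE EFinM.
rewrite integralZl//.
rewrite integral_g -EFinM; congr _%:E.
rewrite -[comp_moment alpha lambda j in RHS](comp_signK j); ring.
Qed.

(** For fixed [w] the sign of [h j] does not depend on [y], so the modulus may be taken outside the
    integral; together with the moment bound this gives integrability on the product. *)
Let integral_abs_h1 j w : (\int[mu]_y `|(h j (y, w))%:E| =
  `|(comp_moment alpha lambda j * (U w `^ alpha * W w ^+ j))%:E|)%E.
Proof.
have s1 : `|comp_sign j| = 1 :> R.
  by rewrite /comp_sign; case: ifP => _; rewrite ?normrN normr1.
have k0 : 0 <= U w `^ alpha * (comp_sign j * comp_moment alpha lambda j).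
  by rewrite -lee_fin -(integral_g j w); apply: integral_ge0 => y _; rewrite lee_fin.
transitivity (\int[mu]_y ((`|W w| ^+ j)%:E * (g j w y)%:E))%E.
  apply: eq_integral => y _; rewrite hE -EFinM /= normrM (ger0_norm (g_ge0 _ _ _)).
  by rewrite normrM s1 mulr1 normrX.
rewrite ge0_integralZl//; last 2 first.
- by apply/measurable_EFinP; exact: mg.
- by move=> y _; rewrite lee_fin.
rewrite integral_g -EFinM /= -normrX; congr _%:E.
rewrite -[U w `^ alpha * _ in LHS]ger0_norm// !normrM s1 mul1r; ring.
Qed.

Let integrable_h j : (j <= m)%N -> muP.-integrable setT (EFin \o h j).
Proof.
move=> jm; apply/integrable21ltyP; first by apply/measurable_EFinP; exact: mh.
under eq_integral do rewrite /= integral_abs_h1.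
have : P.-integrable setT (fun w =>
    (comp_moment alpha lambda j)%:E * (U w `^ alpha * W w ^+ j)%:E)%E.
  by apply: integrableZl => //; exact: integrable_powR_moment.
by move=> /integrableP[_].
Qed.

Let mom j : R := \int[P]_w (U w `^ alpha * W w ^+ j).

Let integral_h j : (j <= m)%N ->
  (\int[muP]_z (h j z)%:E = (comp_moment alpha lambda j * mom j)%:E)%E.
Proof.
move=> jm; rewrite -integral21_prod_meas1; last exact: integrable_h.
under eq_integral do rewrite /fubini_G integral_h1 EFinM.
rewrite integralZl//; last exact: integrable_powR_moment.
by rewrite [RHS]EFinM /mom /Rintegral fineK//; apply: integrable_fin_num => //; exact: integrable_powR_moment.
Qed.

Variable theta : R.

(** Real part at [theta = 0] and imaginary part at [theta = - (pi / 2)] of $e^{iuz - \lambda(yU)^2}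
    - 1 - iuz$, where $z = yUW$. *)
Let f0 u y w : R := expR (- (lambda * (y * U w) ^+ 2)) * cos (u * (y * U w * W w) + theta)
  - \sum_(j < 2) cosq theta j / j`!%:R * (u * (y * U w * W w)) ^+ j.

Let rem u (z : R * T) : R := dens z.1 * (expR (- (lambda * (z.1 * U z.2) ^+ 2)) *
  (cos (u * (z.1 * U z.2 * W z.2) + theta)
   - (cos_taylor theta m.+1).[u * (z.1 * U z.2 * W z.2)])).

(** The compensator consists of the Taylor terms of order below 2 without the Gaussian factor, which
    is what [comp_exp] subtracts. *)
Let f0E u y w : dens y * f0 u y w =
  \sum_(j < m.+1) cosq theta j / j`!%:R * u ^+ j * h j (y, w) + rem u (y, w).
Proof.
rewrite /rem /f0 /h /cos_taylor horner_poly /=.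
set x := y * U w * W w; set E := expR _.
have -> : \sum_(j < m.+1) cosq theta j / j`!%:R * u ^+ j *
    (dens y * ((y * U w) ^+ j * W w ^+ j * comp_exp lambda j (y * U w))) =
    dens y * (E * \sum_(j < m.+1) cosq theta j / j`!%:R * (u * x) ^+ j -
     \sum_(j < m.+1) cosq theta j / j`!%:R * (u * x) ^+ j * (j <= 1)%:R).
  rewrite mulr_sumr -sumrB mulr_sumr; apply: eq_bigr => j _.
  by rewrite /comp_exp -/E /x !exprMn; ring.
rewrite -mulrDr; congr (_ * _).
have -> : \sum_(j < m.+1) cosq theta j / j`!%:R * (u * x) ^+ j * (j <= 1)%:R =
    \sum_(j < 2) cosq theta j / j`!%:R * (u * x) ^+ j.
  case: (m) m_gt1 => [//|[//|n _]].
  rewrite !big_ord_recl big1 ?big_ord0 ?addr0; last by move=> i _; rewrite mulr0.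
  by rewrite /= !mulr1 mulr0 addr0.
ring.
Qed.

Let mcosq u : measurable_fun [set: R * T] (fun z => u * (z.1 * U z.2 * W z.2)).
Proof. by do 2 (apply: measurable_funM => //). Qed.

Let mexp2 : measurable_fun [set: R * T] (fun z => expR (- (lambda * (z.1 * U z.2) ^+ 2))).
Proof.
apply: measurableT_comp => //; apply: measurableT_comp => //.
by apply: measurable_funM => //; exact: (measurableT_comp (exprn_measurable _)).
Qed.

Let mrem u : measurable_fun [set: R * T] (rem u).
Proof.
apply: measurable_funM => //; apply: measurable_funM => //.
apply: measurable_funB.
  apply: (measurableT_comp (continuous_measurable_fun (@continuous_cos R))).
  by apply: measurable_funD.
exact: (measurableT_comp (continuous_measurable_fun (@continuous_horner R _))).
Qed.

Let rem_le u z : `|rem u z| <= 2 * `|u| ^+ m * `|h m z|.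
Proof.
rewrite /rem /h /comp_exp leqNgt m_gt1/= subr0.
set D := dens _; set E := expR _; set C := cos _ - _.
have E0 : `|E| = E by rewrite ger0_norm// expR_ge0.
rewrite [`|D * _|]normrM [`|E * _|]normrM [`|D * _|]normrM [`|_ * E|]normrM E0.
rewrite [leRHS](_ : _ = `|D| * (E * (2 * `|u * (z.1 * U z.2 * W z.2)| ^+ m))).
  by rewrite !ler_wpM2l ?expR_ge0// cos_taylorS_le.
by rewrite -exprMn normrX [`|u * _|]normrM exprMn; ring.
Qed.

(** The extra power of [u] is used pointwise only, since the factor behind it need not be
    integrable; domination comes from [rem_le]. *)
Let rem_small u z : `|rem u z| <= `|u| ^+ m.+1 * (`|dens z.1| * `|z.1 * U z.2 * W z.2| ^+ m.+1).
Proof.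
rewrite /rem normrM [leRHS]mulrCA ler_wpM2l// normrM (ger0_norm (expR_ge0 _)).
rewrite -[leRHS]mul1r ler_pM ?expR_ge0//.
  by rewrite -expR0 ler_expR oppr_le0 mulr_ge0 ?sqr_ge0// ltW.
by apply: le_trans (cos_taylor_le _ _ _) _; rewrite !normrM !exprMn.
Qed.

Let integrable_rem u : muP.-integrable setT (EFin \o rem u).
Proof.
have i2 : muP.-integrable setT (fun z => (2 * `|u| ^+ m)%:E * (EFin \o h m) z)%E.
  by apply: integrableZl => //; exact: integrable_h.
apply: (le_integrable _ _ _ i2) => //; first by apply/measurable_EFinP; exact: mrem.
move=> z _; rewrite /= lee_fin; apply: le_trans (rem_le u z) _.
by rewrite [leRHS]normrM [`|2 * _|]ger0_norm// mulr_ge0// exprn_ge0.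
Qed.

Let integrable_f0 u :
  muP.-integrable setT (fun z => (dens z.1 * f0 u z.1 z.2)%:E).
Proof.
rewrite (_ : (fun z => _) = (fun z => ((\sum_(j < m.+1)
    ((cosq theta j / j`!%:R * u ^+ j)%:E * (h j z)%:E)) + (rem u z)%:E)%E)); last first.
  apply/funext => -[y w]; rewrite f0E EFinD; congr (_ + _)%E.
  by rewrite -sumEFin; apply: eq_bigr => j _; rewrite EFinM.
apply: integrableD => //; last exact: integrable_rem.
apply: integrable_sum => // j _; apply: integrableZl => //.
by apply: integrable_h; rewrite -ltnS.
Qed.

Let integral_f0 u :
  (\int[muP]_z (dens z.1 * f0 u z.1 z.2)%:E =
   (\sum_(j < m.+1) cosq theta j / j`!%:R * u ^+ j * (comp_moment alpha lambda j * mom j))%:E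
   + \int[muP]_z (rem u z)%:E)%E.
Proof.
transitivity (\int[muP]_z ((\sum_(j < m.+1)
    ((cosq theta j / j`!%:R * u ^+ j)%:E * (h j z)%:E)) + (rem u z)%:E))%E.
  apply: eq_integral => -[y w] _; rewrite f0E EFinD; congr (_ + _)%E.
  by rewrite -sumEFin; apply: eq_bigr => j _; rewrite EFinM.
have ih (j : 'I_m.+1) : muP.-integrable setT
    (fun z => (cosq theta j / j`!%:R * u ^+ j)%:E * (h j z)%:E)%E.
  by apply: integrableZl => //; apply: integrable_h; rewrite -ltnS.
rewrite integralD//; last 2 first.
- by apply: integrable_sum => // j _; exact: ih.
- exact: integrable_rem.
congr (_ + _)%E; rewrite integral_sum// -sumEFin; apply: eq_bigr => j _.
rewrite integralZl//; last by apply: integrable_h; rewrite -ltnS.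
by rewrite integral_h -?EFinM// -ltnS.
Qed.

Let integrable_f0_w u y : P.-integrable setT (EFin \o f0 u y).
Proof.
have m1 : measurable_fun [set: T] (fun w => u * (y * U w * W w)).
  by do 2 (apply: measurable_funM => //); exact: measurable_funM.
have i1 : P.-integrable setT (fun w => (2%:E + (u * y)%:E * (U w * W w)%:E)%E).
  apply: integrableD => //; first exact: finite_measure_integrable_cst.
  by apply: integrableZl => //; exact: integrable_UW.
have i2 : P.-integrable setT (fun w => (2%:E + `|(u * y)%:E * (U w * W w)%:E|)%E).
  apply: integrableD => //; first exact: finite_measure_integrable_cst.
  by apply: integrable_abse; apply: integrableZl => //; exact: integrable_UW.
apply: (le_integrable _ _ _ i2) => //.
  apply/measurable_EFinP; apply: measurable_funB.
    apply: measurable_funM.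
      apply: measurableT_comp => //; apply: measurableT_comp => //.
      apply: measurable_funM => //; apply: (measurableT_comp (exprn_measurable _)).
      exact: measurable_funM.
    apply: (measurableT_comp (continuous_measurable_fun (@continuous_cos R))).
    exact: measurable_funD.
  apply: measurable_sum => j; apply: measurable_funM => //.
  exact: (measurableT_comp (exprn_measurable _)).
move=> w _; rewrite /= lee_fin [leRHS]ger0_norm ?addr_ge0//.
rewrite /f0 big_ord_recl big_ord1 /= opprD addrA expr0 expr1 !fact0 divr1 mulr1.
apply: le_trans (ler_normB _ _) _; apply: lerD.
  apply: le_trans (ler_normB _ _) _; rewrite normrM.
  apply: (@le_trans _ _ (1 + 1)); last by [].
  apply: lerD; last exact: cosq_le1.
  rewrite -[leRHS]mulr1 ler_pM ?cos_max// ger0_norm ?expR_ge0//.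
  by rewrite -expR0 ler_expR oppr_le0 mulr_ge0 ?sqr_ge0// ltW.
rewrite /bump/= add1n factS fact0 muln1 divr1 normrM -[leRHS]mul1r ler_pM ?cosq_le1//.
by rewrite (_ : u * (y * U w * W w) = u * y * (U w * W w))//; ring.
Qed.

Let Psi u : R := \int[mu]_(y in `]0, +oo[)
  ((\int[P]_w f0 u y w) * (alpha * y `^ (- alpha - 1))).

Let PsiE u : Psi u = \sum_(j < m.+1)
    cosq theta j / j`!%:R * u ^+ j * (comp_moment alpha lambda j * mom j)
  + fine (\int[muP]_z (rem u z)%:E).
Proof.
have -> : Psi u = fine (\int[muP]_z (dens z.1 * f0 u z.1 z.2)%:E).
  rewrite /Psi /Rintegral; congr fine.
  rewrite -integral12_prod_meas1; last exact: integrable_f0.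
  rewrite integral_mkcond; apply: eq_integral => y _; rewrite patchE /fubini_F.
  under [RHS]eq_integral do rewrite /= EFinM.
  rewrite integralZl//; last exact: integrable_f0_w.
  rewrite /dens indicE; case: ifPn => yD; rewrite ?(negbTE yD) ?mulr0 ?mul0e// mulr1.
  rewrite EFinM muleC fineK//; apply: integrable_fin_num => //.
  exact: integrable_f0_w.
rewrite integral_f0 fineD//; apply: integrable_fin_num => //; exact: integrable_rem.
Qed.

(** Dominated convergence for the remainder divided by $h_n^m$: it tends to 0 pointwise by
    [rem_small] and stays below $2|t|^m |h_m|$, which is integrable, by [rem_le]. *)
Lemma tail_transform_expansion (t : R) (h_ : nat -> R) : (forall n, h_ n != 0) ->
  h_ n @[n --> \oo] --> (0 : R) ->
  (\int[mu]_(y in `]0, +oo[)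
     ((\int[P]_w (expR (- (lambda * (y * U w) ^+ 2)) * cos (t * h_ n * (y * U w * W w) + theta)
        - \sum_(j < 2) cosq theta j / j`!%:R * (t * h_ n * (y * U w * W w)) ^+ j))
      * (alpha * y `^ (- alpha - 1)))
   - \sum_(j < m.+1) cosq theta j / j`!%:R * (t * h_ n) ^+ j *
       (comp_moment alpha lambda j * \int[P]_w (U w `^ alpha * W w ^+ j)))
   / h_ n ^+ m @[n --> \oo] --> (0 : R).
Proof.
move=> h0 ch.
rewrite (_ : (fun n => _) = (fun n => fine (\int[muP]_z (rem (t * h_ n) z / h_ n ^+ m)%:E))); last first.
  apply/funext => n; rewrite -/(f0 (t * h_ n) _ _) -/(Psi (t * h_ n)) PsiE addrAC subrr add0r.
  under [in RHS]eq_integral do rewrite mulrC EFinM.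
  rewrite integralZl//; last exact: integrable_rem.
  by rewrite fineM//; [rewrite mulrC|apply: integrable_fin_num => //; exact: integrable_rem].
have := @dominated_convergence _ _ _ muP setT measurableT
  (fun n z => (rem (t * h_ n) z / h_ n ^+ m)%:E) (cst 0%E)
  (fun z => ((2 * `|t| ^+ m)%:E * `|(h m z)%:E|)%E).
case.
- move=> n; apply/measurable_EFinP; apply: measurable_funM; last exact: measurable_cst.
  exact: mrem.
- exact: measurable_cst.
- apply: aeW => z _; apply: cvg_EFin; first exact: nearW.
  pose K := `|t| ^+ m.+1 * (`|dens z.1| * `|z.1 * U z.2 * W z.2| ^+ m.+1).
  apply/norm_cvg0P; apply: (@squeeze_cvgr _ _ _ _ (cst 0) (fun n => `|h_ n| * K)).
  - apply: nearW => n; rewrite normr_ge0/= normrM normfV normrX.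
    rewrite ler_pdivrMr ?exprn_gt0 ?normr_gt0// mulrAC -exprS mulrA -exprMn mulrC -normrM mulrC.
    exact: rem_small.
  - exact: cvg_cst.
  - rewrite -[X in _ --> X](mul0r K); apply: (@cvgM R); last exact: cvg_cst.
    by apply/norm_cvg0P.
- by apply: integrableZl => //; apply: integrable_abse; exact: integrable_h.
- apply: aeW => z n _; rewrite /= lee_fin normrM normfV normrX.
  rewrite ler_pdivrMr ?exprn_gt0 ?normr_gt0//.
  apply: le_trans (rem_le _ _) _; rewrite normrM exprMn le_eqVlt.
  by apply/orP; left; apply/eqP; ring.
move=> _ _; rewrite integral0 => /fine_cvg; exact.
Qed.

End TailExpansion.

(** * Recovering a moment from a cosine transform *)

Section MomentExtraction.
Context {R : realType} {d : measure_display} {T : measurableType d}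
  (P : probability T R).
Variables (wt xi : T -> R) (m : nat) (e0 : R) (b : nat -> R).
Hypothesis mwt : measurable_fun [set: T] wt.
Hypothesis mxi : measurable_fun [set: T] xi.
Hypothesis wt01 : forall w, 0 <= wt w <= 1.
Hypothesis m_even : ~~ odd m.

Lemma even_expr_ge0 (x : R) : 0 <= x ^+ m.
Proof. by apply: exprn_even_ge0. Qed.

Lemma cosq0_even : cosq (0 : R) m ^+ 2 = 1.
Proof.
have s0 : sin (m%:R * (pi / 2)) = 0 :> R.
  rewrite (_ : m = m./2.*2); last by rewrite -[LHS]odd_double_half (negbTE m_even).
  elim: m./2 => [|n IH]; first by rewrite mul0r sin0.
  rewrite doubleS -addn2 natrD mulrDl (_ : 2%:R * (pi / 2) = pi :> R); last by field.
  by rewrite sinDpi IH oppr0.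
have := @cos2Dsin2 R (m%:R * (pi / 2)).
by rewrite s0 expr0n/= addr0 /cosq add0r.
Qed.

Let F u : R := \int[P]_w (wt w * cos (u * xi w)).

Let int_cos u : P.-integrable setT (fun w => (wt w * cos (u * xi w))%:E).
Proof.
have i1 : P.-integrable setT (cst 1%:E : T -> \bar R).
  exact: finite_measure_integrable_cst.
apply: (le_integrable _ _ _ i1) => //.
  apply/measurable_EFinP; apply: measurable_funM => //.
  apply: (measurableT_comp (continuous_measurable_fun (@continuous_cos R))).
  exact: measurable_funM.
move=> w _; rewrite /= lee_fin normrM normr1 -[leRHS]mulr1.
have /andP[w0 w1] := wt01 w.
by rewrite ler_pM ?cos_max// ger0_norm.
Qed.

(** Up to a sign, the [m]-th centered difference in [u] at 0 of [wt w * cos (u * xi w)], divided by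
    $(2h)^m$. *)
Let phi h (w : T) : R := wt w * (sin (h * xi w) / h) ^+ m.

Let mphi h : measurable_fun [set: T] (phi h).
Proof.
apply: measurable_funM => //; apply: (measurableT_comp (exprn_measurable _)).
apply: measurable_funM => //.
apply: (measurableT_comp (continuous_measurable_fun (@continuous_sin R))).
exact: measurable_funM.
Qed.

(** The sign $i^m$, here [cosq 0 m], squares to 1 and so cancels. *)
Let phi_cdiff h : h != 0 ->
  (\int[P]_w (phi h w)%:E = (cosq 0 m * iter m (cdiff h) F 0 / (2 * h) ^+ m)%:E)%E.
Proof.
move=> h0; have [s hs] := @iter_cdiffE R m.
have phiE w : phi h w = \sum_(p <- s) cosq 0 m / (2 * h) ^+ m * p.1 * (wt w * cos (p.2 * h * xi w)).
  rewrite (eq_bigr (fun p : R * R => cosq 0 m / (2 * h) ^+ m * wt w * (p.1 * cos (p.2 * h * xi w)))); last first.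
    by move=> p _; ring.
  rewrite -mulr_sumr.
  have := @iter_cdiff_cos R m h 0 (xi w) 0.
  rewrite (_ : (fun t => _) = fun t => cos (t * xi w)); last by apply/funext => t; rewrite addr0.
  rewrite hs mul0r !add0r; under eq_bigr do rewrite add0r.
  move=> ->; rewrite /phi.
  have := cosq0_even; rewrite /cosq add0r => c2.
  rewrite !exprMn exprVn.
  have h1 : h ^+ m != 0 by rewrite expf_neq0.
  have h2 : (2 : R) ^+ m != 0 by rewrite expf_neq0.
  rewrite [RHS](_ : _ = cos (m%:R * (pi / 2)) ^+ 2 *
    (wt w * (sin (h * xi w) ^+ m / h ^+ m))); first by rewrite c2 mul1r.
  by field; rewrite h1 h2.
under eq_integral do rewrite phiE -sumEFin.
have ii (p : R * R) : P.-integrable setT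
    (fun w => (cosq 0 m / (2 * h) ^+ m * p.1 * (wt w * cos (p.2 * h * xi w)))%:E).
  by under eq_fun do rewrite EFinM; apply: integrableZl => //; exact: int_cos.
rewrite integral_sum//.
rewrite (eq_bigr (fun p : R * R => (cosq 0 m / (2 * h) ^+ m * (p.1 * F (p.2 * h)))%:E)); last first.
  move=> p _; under eq_integral do rewrite EFinM.
  rewrite integralZl//.
  rewrite mulrA [RHS]EFinM /F /Rintegral fineK//.
  by apply: integrable_fin_num => //; exact: int_cos.
rewrite sumEFin -mulr_sumr hs; under [in RHS]eq_bigr do rewrite add0r.
by congr _%:E; ring.
Qed.

Let h_ (n : nat) : R := n.+1%:R^-1.

Let h_gt0 n : 0 < h_ n. Proof. by rewrite invr_gt0 ltr0n. Qed.

Let cvg_h : h_ n @[n --> \oo] --> (0 : R). Proof. exact: cvg_harmonic. Qed.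

Hypothesis cvgF : forall t : R,
  (F (t * h_ n) - e0 * \sum_(j < m.+1) cosq 0 j * b j * (t * h_ n) ^+ j) / h_ n ^+ m
    @[n --> \oo] --> (0 : R).

(** The difference of the polynomial gives $m!\,b_m(2h)^m$ up to the sign. The error of [F] is
    sampled at finitely many nodes only, where [cvgF] makes it negligible against $h_n^m$. *)
Let cvg_phi : fine (\int[P]_w (phi (h_ n) w)%:E) @[n --> \oo] --> e0 * (m`!%:R * b m).
Proof.
have [s hs] := @iter_cdiffE R m.
pose B u : R := \sum_(j < m.+1) cosq 0 j * b j * u ^+ j.
have EB h : iter m (cdiff h) B 0 = cosq 0 m * b m * (m`!%:R * (2 * h) ^+ m).
  rewrite (@iter_cdiff_sum R m h m.+1 (fun j => cosq 0 j * b j) (fun j t => t ^+ j)).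
  rewrite big_ord_recr /= iter_cdiff_expr// eqxx big1 ?add0r// => i _.
  by rewrite iter_cdiff_expr 1?ltnW// ifF ?mulr0// ltn_eqF.
rewrite (_ : (fun n => _) = fun n => e0 * (m`!%:R * b m) + cosq 0 m / 2 ^+ m *
   \sum_(p <- s) p.1 * ((F (p.2 * h_ n) - e0 * B (p.2 * h_ n)) / h_ n ^+ m)); last first.
  apply/funext => n; have hn0 := lt0r_neq0 (h_gt0 n).
  rewrite phi_cdiff//=.
  have h1 : h_ n ^+ m != 0 by rewrite expf_neq0.
  have h2 : (2 : R) ^+ m != 0 by rewrite expf_neq0.
  have -> : \sum_(p <- s) p.1 * ((F (p.2 * h_ n) - e0 * B (p.2 * h_ n)) / h_ n ^+ m) =
     (iter m (cdiff (h_ n)) F 0 - e0 * iter m (cdiff (h_ n)) B 0) / h_ n ^+ m.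
    rewrite !hs mulr_sumr -sumrB mulr_suml; apply: eq_bigr => p _.
    by rewrite !add0r; ring.
  have := cosq0_even; rewrite EB expr2 => c2.
  rewrite exprMn; set c := cosq 0 m in c2 *.
  rewrite (_ : _ / 2 ^+ m * _ = c * iter m (cdiff (h_ n)) F 0 / (2 ^+ m * h_ n ^+ m) - (c * c) * (e0 * (m`!%:R * b m))).
    by rewrite c2 mul1r; ring.
  by field; rewrite h1 h2.
rewrite -[X in _ --> X]addr0; apply: cvgD; first exact: cvg_cst.
rewrite -[X in _ --> X](mulr0 (cosq 0 m / 2 ^+ m)); apply: (@cvgM R); first exact: cvg_cst.
elim: s {hs} => [|p s IH].
  rewrite (_ : (fun n => _) = cst 0); first exact: cvg_cst.
  by apply/funext => n; rewrite big_nil.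
rewrite (_ : (fun n => _) = fun n => p.1 * ((F (p.2 * h_ n) - e0 * B (p.2 * h_ n)) / h_ n ^+ m) +
  \sum_(p <- s) p.1 * ((F (p.2 * h_ n) - e0 * B (p.2 * h_ n)) / h_ n ^+ m)); last first.
  by apply/funext => n; rewrite big_cons.
rewrite -[X in _ --> X]addr0; apply: cvgD => //.
rewrite -[X in _ --> X](mulr0 p.1); apply: (@cvgM R); first exact: cvg_cst.
exact: cvgF.
Qed.

Let sin_taylor2 (x : R) : `|sin x - x| <= `|x| ^+ 2.
Proof.
have := @cos_taylor_le R 2 (- (pi / 2)) x; rewrite cosBpihalf.
rewrite /cos_taylor horner_poly !big_ord_recl big_ord0 /= /cosq mul0r addr0 addr0.
rewrite cosN cos_pihalf mul0r mul0r add0r mul1r addNr cos0 !divr1 /=.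
by rewrite mul1r expr1.
Qed.

Let sin_le_norm (x : R) : `|sin x| <= `|x|.
Proof.
have := @cos_taylor_le R 1 (- (pi / 2)) x; rewrite cosBpihalf.
rewrite /cos_taylor horner_poly big_ord_recl big_ord0 /= /cosq mul0r addr0 addr0.
by rewrite cosN cos_pihalf !mul0r subr0.
Qed.

Let cvg_phi_pt w : phi (h_ n) w @[n --> \oo] --> wt w * xi w ^+ m.
Proof.
apply: (@cvgM R); first exact: cvg_cst.
have h1 : sin (h_ n * xi w) / h_ n @[n --> \oo] --> xi w.
  have h2 : sin (h_ n * xi w) / h_ n - xi w @[n --> \oo] --> (0 : R).
    apply/norm_cvg0P; apply: (@squeeze_cvgr _ _ _ _ (cst 0) (fun n => h_ n * xi w ^+ 2)).
    - apply: nearW => n; rewrite normr_ge0/=.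
      have hn := h_gt0 n.
      rewrite (_ : _ / _ - _ = (sin (h_ n * xi w) - h_ n * xi w) / h_ n); last first.
        by field; rewrite lt0r_neq0.
      rewrite normrM normfV (gtr0_norm hn) ler_pdivrMr//.
      apply: le_trans (sin_taylor2 _) _.
      rewrite real_normK ?num_real// exprMn le_eqVlt; apply/orP; left; apply/eqP; ring.
    - exact: cvg_cst.
    - by rewrite -[X in _ --> X](mul0r (xi w ^+ 2)); apply: (@cvgM R); [exact: cvg_h|exact: cvg_cst].
  exact/subr_cvg0.
exact: (@cvg_comp _ _ _ _ (fun x => x ^+ m) _ _ _ h1 (@exprn_continuous R m (xi w))).
Qed.

Lemma integral_moment_transform :
  (\int[P]_w (wt w * xi w ^+ m)%:E = (e0 * (m`!%:R * b m))%:E)%E.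
Proof.
have phi0 h w : 0 <= phi h w.
  by have /andP[w0 _] := wt01 w; rewrite mulr_ge0// even_expr_ge0.
have fin_phi n : (\int[P]_w (phi (h_ n) w)%:E)%E \is a fin_num.
  by rewrite phi_cdiff// lt0r_neq0.
have cE : (\int[P]_w (phi (h_ n) w)%:E)%E @[n --> \oo] --> (e0 * (m`!%:R * b m))%:E.
  by apply/fine_cvgP; split; [exact: nearW|exact: cvg_phi].
have mxm : measurable_fun [set: T] (fun w => (wt w * xi w ^+ m)%:E).
  apply/measurable_EFinP; apply: measurable_funM => //.
  exact: (measurableT_comp (exprn_measurable _)).
have xm0 w : 0 <= wt w * xi w ^+ m.
  by have /andP[w0 _] := wt01 w; rewrite mulr_ge0// even_expr_ge0.
(* Integrability of the limit is not known beforehand; Fatou's lemma bounds its integral by the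
   finite limit of the integrals of [phi]. *)
have := @fatou _ T R P setT measurableT (fun n w => (phi (h_ n) w)%:E).
have -> : (\int[P]_w limn_einf (fun n => (phi (h_ n) w)%:E) = \int[P]_w (wt w * xi w ^+ m)%:E)%E.
  apply: eq_integral => w _.
  have c : (phi (h_ n) w)%:E @[n --> \oo] --> (wt w * xi w ^+ m)%:E.
    by apply: cvg_EFin; [exact: nearW|exact: cvg_phi_pt].
  by have [-> _] := cvg_limn_einf_sup c.
have [-> _] := cvg_limn_einf_sup cE.
move=> fat; have {}fat := fat _ _.
have ix : P.-integrable setT (fun w => (wt w * xi w ^+ m)%:E).
  apply/integrableP; split => //.
  under eq_integral do rewrite gee0_abs ?lee_fin//.
  apply: le_lt_trans (fat _ _) _; last by rewrite ltry.
  - by move=> n; apply/measurable_EFinP; exact: mphi.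
  - by move=> n w _; rewrite lee_fin.
(* Since $|\sin(h\xi)| \le h|\xi|$, the limit itself dominates the whole sequence. *)
have [] := @dominated_convergence _ _ _ P setT measurableT
  (fun n w => (phi (h_ n) w)%:E) (fun w => (wt w * xi w ^+ m)%:E) (fun w => (wt w * xi w ^+ m)%:E).
- by move=> n; apply/measurable_EFinP; exact: mphi.
- by [].
- apply: aeW => w _; apply: cvg_EFin; [exact: nearW|exact: cvg_phi_pt].
- by [].
- apply: aeW => w n _; rewrite /= lee_fin ger0_norm//.
  have /andP[w0 _] := wt01 w; rewrite ler_wpM2l//.
  rewrite -[leLHS]ger0_norm ?even_expr_ge0// -[leRHS]ger0_norm ?even_expr_ge0//.
  rewrite !normrX lerXn2r ?nnegrE// normrM normfV (gtr0_norm (h_gt0 n)) ler_pdivrMr//.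
  by apply: le_trans (sin_le_norm _) _; rewrite normrM (gtr0_norm (h_gt0 n)) mulrC.
move=> _ _ c2; exact: (cvg_unique _ c2 cE).
Qed.

End MomentExtraction.

(** * Perturbation of $e^X \cos Y$ *)

Section ExpCosPerturbation.
Context {R : realType}.

Lemma expR_sub1_le (x : R) : `|x| <= 2^-1 -> `|expR x - 1| <= 2 * `|x|.
Proof.
rewrite ler_norml => /andP[x1 x2].
have e1 := expR_ge1Dx x; have e2 := expR_ge1Dx (- x).
have e3 : expR x * expR (- x) = 1 by rewrite expRxMexpNx_1.
have e4 := expR_gt0 x.
have e5 : expR x * (1 - x) <= 1 by rewrite -[leRHS]e3 ler_wpM2l// ltW.
have [x0|x0] := leP 0 x.
  by rewrite !ger0_norm//; nra.
by rewrite (ltr0_norm x0) ler_norml; apply/andP; split; nra.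
Qed.

Lemma cos_lipschitz (x y : R) : `|cos x - cos y| <= `|x - y|.
Proof.
have := @le_norm_sub0 R (fun z => cos (y + z)) (fun z => - sin (y + z)) (x - y) 1.
rewrite addr0 mul1r (_ : y + (x - y) = x); last by ring.
apply=> [z|z _]; last by rewrite normrN sin_max.
by apply: is_derive_eq; rewrite /GRing.scale/=; ring.
Qed.

(** Factor out $e^{X'}$, which stays bounded because [X'] converges; the rest follows from $|e^x -
    1| \le 2|x|$ near 0 and the Lipschitz bound for the cosine. *)
Lemma cvg_expR_cos_perturbation (X X' Y Y' r : nat -> R) (x0 : R) :
  (forall n, 0 < r n) -> r n @[n --> \oo] --> (0 : R) ->
  X' n @[n --> \oo] --> x0 ->
  (X n - X' n) / r n @[n --> \oo] --> (0 : R) ->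
  (Y n - Y' n) / r n @[n --> \oo] --> (0 : R) ->
  (expR (X n) * cos (Y n) - expR (X' n) * cos (Y' n)) / r n @[n --> \oo] --> (0 : R).
Proof.
move=> r0 cr cX' cX cY.
have cXX : X n - X' n @[n --> \oo] --> (0 : R).
  rewrite (_ : (fun n => X n - X' n) = fun n => (X n - X' n) / r n * r n); last first.
    by apply/funext => n; rewrite mulfVK ?lt0r_neq0.
  by rewrite -[X in _ --> X](mul0r 0); apply: (@cvgM R).
apply/norm_cvg0P.
apply: (@squeeze_cvgr _ _ _ _ (cst 0)
  (fun n => expR (X' n) * (2 * `|(X n - X' n) / r n| + `|(Y n - Y' n) / r n|))).
- near=> n; rewrite normr_ge0/=.
  have Xs : `|X n - X' n| <= 2^-1.
    rewrite -normrN -sub0r; near: n; move/cvgrPdist_le : cXX; apply.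
    by rewrite invr_gt0.
  rewrite (_ : expR (X n) * cos (Y n) - _ = expR (X' n) *
    ((expR (X n - X' n) - 1) * cos (Y n) + (cos (Y n) - cos (Y' n)))); last first.
    have -> : expR (X n) = expR (X' n) * expR (X n - X' n) by rewrite -expRD addrC subrK.
    ring.
  rewrite normrM normfV (gtr0_norm (r0 n)) ler_pdivrMr// normrM (ger0_norm (expR_ge0 _)).
  rewrite -mulrA ler_wpM2l ?expR_ge0// !normrM !normfV (gtr0_norm (r0 n)).
  rewrite [leRHS](_ : _ = 2 * `|X n - X' n| + `|Y n - Y' n|); last first.
    by field; rewrite lt0r_neq0.
  apply: le_trans (ler_normD _ _) _; apply: lerD; last exact: cos_lipschitz.
  rewrite normrM -[leRHS]mulr1 ler_pM ?cos_max//; exact: expR_sub1_le.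
- exact: cvg_cst.
- rewrite -[X in _ --> X](mulr0 (expR x0)); apply: (@cvgM R).
    exact: (@cvg_comp _ _ _ _ expR _ _ _ cX' (@continuous_expR R x0)).
  rewrite -[X in _ --> X]addr0 -[X in _ --> X + _](mulr0 2); apply: cvgD.
    by apply: (@cvgM R); [exact: cvg_cst|apply/norm_cvg0P].
  by apply/norm_cvg0P.
Unshelve. all: by end_near. Qed.

End ExpCosPerturbation.

(** * From the joint transform to the weighted moment *)

Section TransformMoment.
Context {R : realType} {d : measure_display} {T : measurableType d}
  (P : probability T R) {d' : measure_display} {T' : measurableType d'}
  (P' : probability T' R).
Local Notation mu := (@lebesgue_measure R).

Lemma integral_transform_moment (U W : T -> R) (xi zeta : T' -> R)
    (alpha lambda : R) (m : nat) (b : nat -> R) :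
  measurable_fun [set: T] U -> measurable_fun [set: T] W ->
  measurable_fun [set: T'] xi -> measurable_fun [set: T'] zeta ->
  (forall w, 0 <= U w <= 1) -> 1 < alpha < 2 -> 0 < lambda ->
  (1 < m)%N -> ~~ odd m ->
  P.-integrable setT (fun w => (U w `^ alpha * `|W w| ^+ m)%:E) ->
  let psi theta u := \int[mu]_(y in `]0, +oo[)
     ((\int[P]_w (expR (- (lambda * (y * U w) ^+ 2)) * cos (u * (y * U w * W w) + theta)
        - \sum_(j < 2) cosq theta j / j`!%:R * (u * (y * U w * W w)) ^+ j))
      * (alpha * y `^ (- alpha - 1))) in
  (forall u, \int[P']_w (expR (- (lambda * zeta w ^+ 2)) * cos (u * xi w)) =
     expR (psi 0 u) * cos (psi (- (pi / 2)) u)) ->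
  let a j := comp_moment alpha lambda j * \int[P]_w (U w `^ alpha * W w ^+ j) / j`!%:R in
  b 0%N = 1 ->
  (forall n, (n < m)%N ->
    n.+1%:R * b n.+1 = \sum_(j < n.+1) j.+1%:R * a j.+1 * b (n - j)%N) ->
  (\int[P']_w (expR (- (lambda * zeta w ^+ 2)) * xi w ^+ m)%:E =
   (expR (a 0%N) * (m`!%:R * b m))%:E)%E.
Proof.
move=> mU mW mxi mzeta U01 a12 l0 m1 mev iW psi hpsi a b0 brec.
apply: (@integral_moment_transform R d' T' P' (fun w => expR (- (lambda * zeta w ^+ 2))) xi m (expR (a 0%N)) b) => //.
- apply: measurableT_comp => //; apply: measurableT_comp => //.
  by apply: measurable_funM => //; exact: (measurableT_comp (exprn_measurable _)).
- move=> w; rewrite expR_ge0/= -expR0 ler_expR oppr_le0 mulr_ge0 ?sqr_ge0//.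
  exact: ltW.
move=> t.
pose h n : R := n.+1%:R^-1.
have h0 n : 0 < h n by rewrite invr_gt0 ltr0n.
have ch : h n @[n --> \oo] --> (0 : R) by exact: cvg_harmonic.
pose p theta (u : R) := \sum_(j < m.+1) cosq theta j / j`!%:R * u ^+ j *
  (comp_moment alpha lambda j * \int[P]_w (U w `^ alpha * W w ^+ j)).
have cpsi theta : (psi theta (t * h n) - p theta (t * h n)) / h n ^+ m @[n --> \oo] --> (0 : R).
  apply: tail_transform_expansion => // n; exact: lt0r_neq0.
have cth : t * h n @[n --> \oo] --> (0 : R).
  by rewrite -[X in _ --> X](mulr0 t); apply: (@cvgM R); [exact: cvg_cst|].
have chm : h n ^+ m @[n --> \oo] --> (0 : R).
  have := @cvg_comp _ _ _ _ (fun x => x ^+ m) _ _ _ ch (@exprn_continuous R m 0).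
  by rewrite /= expr0n gtn_eqF// ltnW.
have cp : p 0 (t * h n) @[n --> \oo] --> p 0 0.
  pose q : {poly R} := \poly_(j < m.+1) (cosq 0 j / j`!%:R *
    (comp_moment alpha lambda j * \int[P]_w (U w `^ alpha * W w ^+ j))).
  have pq : p 0 = horner q.
    by apply/funext => u; rewrite /p /q horner_poly; apply: eq_bigr => j _; rewrite mulrAC.
  rewrite pq; exact: (@cvg_comp _ _ _ _ (horner q) _ _ _ cth (@continuous_horner R q 0)).
have L1 := @cvg_expR_cos_perturbation R (fun n => psi 0 (t * h n)) (fun n => p 0 (t * h n))
  (fun n => psi (- (pi / 2)) (t * h n)) (fun n => p (- (pi / 2)) (t * h n)) (fun n => h n ^+ m)
  (p 0 0) (fun n => exprn_gt0 m (h0 n)) chm cp (cpsi 0) (cpsi (- (pi / 2))).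
have [C hC] := @expR_poly_cos_expansion R m a b b0 brec.
pose B (u : R) := \sum_(j < m.+1) cosq 0 j * b j * u ^+ j.
have pE theta u : p theta u = cosq theta 0 * a 0%N +
    \sum_(1 <= j < m.+1) cosq theta j * a j * u ^+ j.
  rewrite /p big_ord_recl big_add1/= big_mkord; congr (_ + _).
    by rewrite /a expr0 fact0 !divr1 mulr1.
  by apply: eq_bigr => j _; rewrite /a /bump/= add1n; ring.
have L2 : (expR (p 0 (t * h n)) * cos (p (- (pi / 2)) (t * h n)) - expR (a 0%N) * B (t * h n)) /
    h n ^+ m @[n --> \oo] --> (0 : R).
  apply/norm_cvg0P; apply: (@squeeze_cvgr _ _ _ _ (cst 0)
    (fun n => expR (a 0%N) * C * `|t| ^+ m.+1 * h n)).
  - near=> n; rewrite normr_ge0/=.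
    have u1 : `|t * h n| <= 1.
      by rewrite -normrN -sub0r; near: n; move/cvgrPdist_le : cth; exact.
    have := hC _ u1; rewrite -/(B _) !pE.
    (* The constant term of the exponent is real: it enters as the factor $e^{a_0}$ and leaves the
       cosine untouched. *)
    have -> : cosq (0 : R) 0 = 1 by rewrite /cosq mul0r addr0 cos0.
    have -> : cosq (- (pi / 2) : R) 0 = 0 by rewrite /cosq mul0r addr0 cosN cos_pihalf.
    rewrite mul1r mul0r add0r expRD -[_ * _ * cos _]mulrA -mulrBr => hh.
    rewrite normrM normfV (gtr0_norm (exprn_gt0 m (h0 n))).
    rewrite ler_pdivrMr ?exprn_gt0// normrM (ger0_norm (expR_ge0 _)).
    rewrite -!mulrA ler_wpM2l ?expR_ge0//.
    apply: le_trans hh _; rewrite normrM exprMn (gtr0_norm (h0 n)) exprSr.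
    by rewrite [h n ^+ m.+1]exprS.
  - exact: cvg_cst.
  - by rewrite -[X in _ --> X](mulr0 (expR (a 0%N) * C * `|t| ^+ m.+1)); apply: (@cvgM R); [exact: cvg_cst|].
rewrite (_ : (fun n => _) = fun n =>
   (expR (psi 0 (t * h n)) * cos (psi (- (pi / 2)) (t * h n)) -
    expR (p 0 (t * h n)) * cos (p (- (pi / 2)) (t * h n))) / h n ^+ m +
   (expR (p 0 (t * h n)) * cos (p (- (pi / 2)) (t * h n)) - expR (a 0%N) * B (t * h n)) / h n ^+ m).
  by rewrite -[X in _ --> X]addr0; apply: cvgD.
by apply/funext => n; rewrite hpsi -mulrDl addrA subrK.
Unshelve. all: by end_near. Qed.

End TransformMoment.

(** * Unrolling the recursion over compositions *)

Section Compositions.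
Context {F : numFieldType}.
Variables (kap : nat -> F) (N : nat).

(** [x.+1] is the size of the part taken and [r] what remains after it. Solving the recursion for
    [b r] divides by [r]; the divisor is 1 when nothing remains. *)
Let wgt (x r : nat) : F := kap x.+1 / (x`!%:R * (maxn 1 r)%:R).

(** Sum over the compositions of [n] into [k] parts $l_j + 1$, each part weighted according to what
    it leaves. *)
Let compsum (k n : nat) : F :=
  \sum_(l : {ffun 'I_k -> 'I_N} | (\sum_(j < k) (l j).+1 == n)%N)
    \prod_(j < k) wgt (l j) (n - \sum_(i < k | (i <= j)%N) (l i).+1)%N.

Let compsum0 n : compsum 0 n = (n == 0%N)%:R.
Proof.
rewrite /compsum (eq_bigl (fun=> n == 0%N)); last by move=> l; rewrite big_ord0 eq_sym.
case: (n == 0%N); last by rewrite big_pred0_eq.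
under eq_bigr do rewrite big_ord0.
by rewrite sumr_const card_ffun !card_ord.
Qed.

Let fcons k (p : 'I_N * {ffun 'I_k -> 'I_N}) : {ffun 'I_k.+1 -> 'I_N} :=
  [ffun i => if unlift ord0 i is Some j then p.2 j else p.1].

Let fcons0 k p : @fcons k p ord0 = p.1.
Proof. by rewrite ffunE unlift_none. Qed.

Let fconsS k p j : @fcons k p (lift ord0 j) = p.2 j.
Proof. by rewrite ffunE liftK. Qed.

(** Peels off the first part, [fcons] being the bijection. *)
Let compsumS k n : compsum k.+1 n =
  \sum_(x < N | (x < n)%N) wgt x (n - x.+1)%N * compsum k (n - x.+1)%N.
Proof.
rewrite /compsum.
rewrite (reindex (@fcons k)) /=; last first.
  exists (fun l => (l ord0, [ffun i => l (lift ord0 i)])) => [[x l] _|l _].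
    rewrite fcons0; congr pair; apply/ffunP => i; by rewrite ffunE fconsS.
  apply/ffunP => i; rewrite ffunE; case: unliftP => [j ->|->] //=.
  by rewrite ffunE.
under [RHS]eq_bigr do rewrite mulr_sumr.
rewrite pair_big_dep /=; apply: eq_big => [[x l]|[x l] _] /=.
  rewrite big_ord_recl fcons0 /=; under eq_bigr do rewrite fconsS.
  by set s := (\sum_(j < k) _)%N; apply/eqP/andP => [|[+ /eqP]]; lia.
rewrite big_ord_recl fcons0 /=; congr (_ * _).
  congr (wgt _ (n - _)); rewrite big_mkcond big_ord_recl /= fcons0/= big1 ?addn0//.
apply: eq_bigr => j _; rewrite fconsS /=; congr wgt.
rewrite -subnDA; congr (n - _)%N.
rewrite big_mkcond big_ord_recl /= fcons0; congr addn.
by rewrite [RHS]big_mkcond; apply: eq_bigr => i _; rewrite fconsS /bump /= !add1n ltnS.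
Qed.

Let compsum_small k n : (n < k)%N -> compsum k n = 0.
Proof.
move=> nk; rewrite /compsum big1// => l /eqP h; exfalso.
have : (k <= \sum_(j < k) (l j).+1)%N.
  rewrite -[X in (X <= _)%N]card_ord -sum1_card; exact: leq_sum.
by rewrite h leqNgt nk.
Qed.

(** Strong induction: the recursion chooses the first part [j.+1], and solving the induction
    hypothesis at [n - j] for [b] gives the divisor in [wgt]. Any [K >= n] will do, as [n] has no
    composition into more than [n] parts. *)
Let sum_compsum (b : nat -> F) (K n : nat) : b 0%N = 1 -> (n < N)%N -> (n <= K)%N ->
  (forall i, (i < n)%N ->
     i.+1%:R * b i.+1 = \sum_(j < i.+1) kap j.+1 / j`!%:R * b (i - j)%N) ->
  \sum_(k < K.+1) compsum k n = b n * (maxn 1 n)%:R.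
Proof.
move=> b0; elim/ltn_ind: n K => n IH K nN nK brec.
case: n => [|n] in IH nN nK brec *.
  rewrite big_ord_recl compsum0 eqxx /= big1 ?addr0 ?b0 ?mulr1//.
  by move=> i _; rewrite compsum_small.
rewrite big_ord_recl compsum0 /= add0r (maxn_idPr _)// mulrC brec//.
under eq_bigr do rewrite compsumS.
rewrite exchange_big /=.
under eq_bigr do rewrite -mulr_sumr.
have -> : \sum_(x < N | (x < n.+1)%N) wgt x (n.+1 - x.+1)%N * \sum_(i < K) compsum i (n.+1 - x.+1)%N
    = \sum_(x < n.+1) wgt x (n - x)%N * \sum_(i < K) compsum i (n - x)%N.
  rewrite (big_ord_widen_cond N xpredT (fun x => wgt x (n - x)%N * \sum_(i < K) compsum i (n - x)%N))//.
  by rewrite ltnW.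
apply: eq_bigr => x _; case: K => [//|K] in nK *.
have xn := ltn_ord x.
rewrite (IH (n - x)%N)//; last 4 first.
- lia.
- lia.
- lia.
- by move=> i ix; apply: brec; lia.
rewrite /wgt; field.
by rewrite !pnatr_eq0 -!lt0n fact_gt0 leq_max.
Qed.

Lemma sum_compositions_unroll (b : nat -> F) (m : nat) : (0 < m < N)%N -> b 0%N = 1 ->
  (forall n, (n < m)%N ->
     n.+1%:R * b n.+1 = \sum_(j < n.+1) kap j.+1 / j`!%:R * b (n - j)%N) ->
  m`!%:R * b m = (m.-1)`!%:R * \sum_(1 <= k < m.+1)
    \sum_(l : {ffun 'I_k -> 'I_N} | (\sum_(j < k) l j == m - k)%N)
      \prod_(j < k) (kap (l j).+1 / ((l j)`!%:R *
         (maxn 1 (m - j.+1 - \sum_(i < k | (i <= j)%N) l i))%:R)).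
Proof.
move=> /andP[m0 mN] b0 brec.
have := @sum_compsum b m m b0 mN (leqnn m) brec.
rewrite big_ord_recl compsum0 gtn_eqF// add0r (maxn_idPr _)// => h.
rewrite -[in LHS](prednK m0) factS natrM prednK// mulrAC -mulrA mulrC mulrAC.
rewrite -h mulrC big_add1 big_mkord; congr (_ * _).
apply: eq_bigr => k _; rewrite lift0.
have sumS (l : {ffun 'I_k.+1 -> 'I_N}) (p : pred 'I_k.+1) :
    (\sum_(j < k.+1 | p j) (l j).+1 = #|p| + \sum_(j < k.+1 | p j) l j)%N.
  rewrite -sum1_card -big_split/=; exact: eq_bigr.
apply: eq_big => [l|l _].
  rewrite sumS card_ord; have := ltn_ord k; set s := (\sum_(j < k.+1) _)%N => km.
  by apply/eqP/eqP => h'; move: h' km; rewrite /=; lia.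
apply: eq_bigr => j _; congr (_ / (_ * (maxn 1 _)%:R)).
(* The parts up to index [j] exceed the sum of the [l i] by their number [j.+1]; indices start at 0
   here and at 1 in the formula. *)
rewrite sumS subnDA; congr (m - _ - _)%N.
have -> : #|[pred i : 'I_k.+1 | (i <= j)%N]| = j.+1.
  rewrite -sum1_card (eq_bigl (fun i : 'I_k.+1 => (i < j.+1)%N))//.
  rewrite -(big_ord_widen k.+1 (fun=> 1%N)) ?ltn_ord// sum1_card card_ord//.
by [].
Qed.

End Compositions.

(** * Sums indexed by the integers *)

Section IntegerSums.
Context {R : realType}.

Lemma esum_intE (a : int -> \bar R) : (forall t, (0 <= a t)%E) ->
  (\esum_(t in [set: int]) a t =
   \sum_(0 <= n <oo) a (Posz n) + \sum_(0 <= n <oo) a (Negz n))%E.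
Proof.
move=> a0; rewrite (esumID (range Posz))//; congr (_ + _)%E.
  rewrite setTI esum_image; last by move=> x y _ _ [].
  by rewrite nneseries_esumT.
rewrite setTI nneseries_esumT//.
rewrite (_ : ~` range Posz = range Negz); last first.
  apply/seteqP; split=> [[n|n] /= h|_ [n _ <-] [k _]//]; last by exists n.
  by exfalso; apply: h; exists n.
by rewrite esum_image// => x y _ _ [].
Qed.

Lemma esum_intZl (c : R) (a : int -> \bar R) : (forall t, (0 <= a t)%E) -> 0 <= c ->
  (\esum_(t in [set: int]) (c%:E * a t) = c%:E * \esum_(t in [set: int]) a t)%E.
Proof.
move=> a0 c0; rewrite !esum_intE//; last by move=> t; rewrite mule_ge0.
by rewrite !nneseriesZl// ge0_muleDr//; apply: nneseries_ge0.
Qed.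

Lemma le_esum_int (a : int -> \bar R) t : (forall t, (0 <= a t)%E) ->
  (a t <= \esum_(s in [set: int]) a s)%E.
Proof.
move=> a0; rewrite (esumID [set t])// setTI esum_set1// leeDl// esum_ge0//.
Qed.

Lemma measurable_esum_int d (T : measurableType d) (a : int -> T -> \bar R) :
  (forall t w, (0 <= a t w)%E) -> (forall t, measurable_fun [set: T] (a t)) ->
  measurable_fun [set: T] (fun w => (\esum_(t in [set: int]) a t w)%E).
Proof.
move=> a0 ma.
rewrite (_ : (fun w => _) = fun w =>
  (\sum_(0 <= n <oo) a (Posz n) w + \sum_(0 <= n <oo) a (Negz n) w)%E); last first.
  by apply/funext => w; rewrite esum_intE.
by apply: emeasurable_funD; apply: ge0_emeasurable_sum.
Qed.

End IntegerSums.

(** * Measurability and norms on the sequence space *)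

Section SequenceMeasurability.
Context {R : realType}.

Local Notation seqspace := (g_sigma_algebraType (@seq_cylinder R)).

Lemma measurable_coord (t : int) :
  measurable_fun [set: seqspace] (fun x : seqspace => (x : int -> R) t).
Proof.
move=> _ B mB; rewrite setTI; apply: sub_sigma_algebra.
by exists t, B.
Qed.

Lemma measurable_to_seqspace d (T : measurableType d) (f : T -> seqspace) :
  (forall t, measurable_fun [set: T] (fun w => (f w : int -> R) t)) ->
  measurable_fun [set: T] f.
Proof.
move=> mf; apply: (@measurability _ _ T seqspace setT f (@seq_cylinder R) erefl).
move=> _ [_ [t [B [mB ->]]] <-]; exact: mf.
Qed.

Lemma measurable_zsum : measurable_fun [set: seqspace] (zsum : seqspace -> R).
Proof.
have m (g : R -> R) : measurable_fun [set: R] g -> (forall x, 0 <= g x) ->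
    measurable_fun [set: seqspace] (fun x : seqspace =>
      fine (\esum_(t in [set: int]) (g ((x : int -> R) t))%:E)%E).
  move=> mg g0; apply: (measurableT_comp (fine_measurable measurableT)).
  apply: measurable_esum_int => [t x|t]; first by rewrite lee_fin.
  by apply/measurable_EFinP; apply: (measurableT_comp mg); exact: measurable_coord.
apply: measurable_funB.
- by apply: (m (fun y => Num.max y 0)) => [|x]; [exact: measurable_maxr|rewrite le_max lexx orbT].
- apply: (m (fun y => Num.max (- y) 0)) => [|x]; last by rewrite le_max lexx orbT.
  by apply: measurable_maxr.
Qed.

Lemma measurable_lpnorm p : measurable_fun [set: seqspace] (lpnorm p : seqspace -> R).
Proof.
apply: (measurableT_comp (measurable_powR _)).
apply: (measurableT_comp (fine_measurable measurableT)).
apply: measurable_esum_int => [t x|t]; first by rewrite lee_fin powR_ge0.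
apply/measurable_EFinP; apply: (measurableT_comp (measurable_powR _)).
by apply: measurableT_comp => //; exact: measurable_coord.
Qed.

Lemma measurable_lpnormalize p :
  measurable_fun [set: seqspace] (lpnormalize p : seqspace -> seqspace).
Proof.
apply: measurable_to_seqspace => t; rewrite /lpnormalize.
rewrite (_ : (fun w => _) = fun x : seqspace => (x : int -> R) t * lpnorm p x `^ (-1)).
  apply: measurable_funM; first exact: measurable_coord.
  by apply: (measurableT_comp (measurable_powR _)); exact: measurable_lpnorm.
by apply/funext => x; rewrite powR_inv1// powR_ge0.
Qed.

(** Divergent sums are covered: [fine] sends an infinite positive or negative part to 0, before and
    after scaling. *)
Lemma zsumZ (c : R) (x : int -> R) : 0 <= c -> zsum (fun t => x t * c) = zsum x * c.
Proof.
move=> c0; rewrite /zsum mulrBl.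
have E (g : R -> R) : (forall y, 0 <= g y) -> (forall y, g (y * c) = c * g y) ->
    fine (\esum_(t in [set: int]) (g (x t * c))%:E)%E = fine (\esum_(t in [set: int]) (g (x t))%:E)%E * c.
  move=> g0 gc; rewrite (eq_esum (b := fun t => (c%:E * (g (x t))%:E)%E)); last first.
    by move=> t _; rewrite gc EFinM.
  rewrite esum_intZl// => [|t]; last by rewrite lee_fin.
  case: (\esum_(t in _) _)%E => [r| |] /=; rewrite ?mul0r; first by rewrite mulrC.
    by move: c0; rewrite le_eqVlt => /predU1P[<-|c0]; rewrite ?mul0e// gt0_muley.
  by move: c0; rewrite le_eqVlt => /predU1P[<-|c0]; rewrite ?mul0e// gt0_muleNy.
congr (_ - _).
- apply: (E (fun y => Num.max y 0)) => y; first by rewrite le_max lexx orbT.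
  by rewrite -[in LHS](mul0r c) -maxr_pMl// mulrC.
- apply: (E (fun y => Num.max (- y) 0)) => y; first by rewrite le_max lexx orbT.
  by rewrite -[in LHS](mul0r c) -mulNr -maxr_pMl// mulrC.
Qed.

(** The value is 1 when the sum for [x] is finite and nonzero. Otherwise [lpnorm] is 0 and division
    by 0 makes the normalized sequence zero, hence an inequality. *)
Lemma esum_lpnormalize_le1 (p : R) (x : int -> R) : 0 < p ->
  (\esum_(t in [set: int]) (`|lpnormalize p x t| `^ p)%:E <= 1)%E.
Proof.
move=> p0; rewrite /lpnormalize.
have a0 t : (0 <= (`|x t| `^ p)%:E)%E by rewrite lee_fin powR_ge0.
have [N0|N0] := eqVneq (lpnorm p x) 0.
  by rewrite N0 esum1// => t _; rewrite invr0 mulr0 normr0 powR0// lt0r_neq0.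
set N := lpnorm p x in N0 *.
set e := (\esum_(t in [set: int]) (`|x t| `^ p)%:E)%E.
have Ne : N = fine e `^ p^-1 by [].
have fe0 : fine e != 0.
  by apply: contra_neq N0 => h; rewrite Ne h powR0// invr_eq0 lt0r_neq0.
have Ngt0 : 0 < N by rewrite lt_neqAle eq_sym N0 powR_ge0.
have fe : e = (fine e)%:E by move: fe0; case: (e) => //=; rewrite eqxx.
rewrite (eq_esum (b := fun t => ((N `^ p)^-1%:E * (`|x t| `^ p)%:E)%E)); last first.
  move=> t _; rewrite normrM normfV (gtr0_norm Ngt0) powRM ?invr_ge0 ?(ltW Ngt0)//.
  by rewrite -(powR_inv1 (ltW Ngt0)) -powRrM mulN1r powRN -EFinM mulrC.
rewrite esum_intZl ?invr_ge0 ?powR_ge0// -/e fe -EFinM lee_fin.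
have -> : N `^ p = fine e.
  rewrite Ne -powRrM mulVf ?lt0r_neq0// powRr1//.
  by rewrite -lee_fin -fe esum_ge0.
by rewrite mulVf.
Qed.

(** Every $|x_t|$ is at most 1, so $x_t^2 \le |x_t|^p$. If the 2-norm is 0 then all $x_t$ vanish, so
    the last identity survives the division by 0. *)
Lemma lpnorm2_le1 (p : R) (x : int -> R) : 0 < p <= 2 ->
  (\esum_(t in [set: int]) (`|x t| `^ p)%:E <= 1)%E ->
  [/\ zsum (fun t => x t ^+ 2) = lpnorm 2 x ^+ 2, 0 <= lpnorm 2 x <= 1 &
      zsum x = lpnorm 2 x * zsum (lpnormalize 2 x)].
Proof.
move=> /andP[p0 p2] x1.
have a0 (q : R) t : (0 <= (`|x t| `^ q)%:E)%E by rewrite lee_fin powR_ge0.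
have xt1 t : `|x t| <= 1.
  have := le_trans (le_esum_int t (a0 p)) x1; rewrite lee_fin => h.
  rewrite leNgt; apply/negP => xt.
  have : 1 `^ p < `|x t| `^ p by apply: gt0_ltr_powR => //; rewrite nnegrE.
  by rewrite powR1 ltNge h.
have le2 : (\esum_(t in [set: int]) (`|x t| `^ 2)%:E <= 1)%E.
  apply: le_trans x1; apply: le_esum => t _; rewrite lee_fin.
  have [x0|x0] := leP `|x t| 0.
    have -> : `|x t| = 0 by apply/eqP; rewrite eq_le x0 normr_ge0.
    by rewrite !powR0// lt0r_neq0.
  by apply: ger_powR => //; rewrite x0 xt1.
set e := (\esum_(t in [set: int]) (`|x t| `^ 2)%:E)%E in le2.
have e0 : (0 <= e)%E by rewrite esum_ge0.
have fe : e = (fine e)%:E by rewrite fineK// ge0_fin_numE// (le_lt_trans le2)// ltry.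
have fe0 : 0 <= fine e by rewrite fine_ge0.
have NE : lpnorm 2 x = fine e `^ 2^-1 by [].
have N2 : lpnorm 2 x ^+ 2 = fine e.
  by rewrite NE -powR_mulrn ?powR_ge0// -powRrM mulVf// powRr1.
split.
- rewrite N2 /zsum (_ : (\esum_(t in _) ((fun t => x t ^+ 2)^\- t)%:E)%E = 0%E); last first.
    by apply: esum1 => t _; congr _%:E; apply/max_idPr; rewrite oppr_le0 sqr_ge0.
  rewrite subr0; congr fine; apply: eq_esum => t _; congr _%:E.
  rewrite powR_mulrn// real_normK ?num_real//.
  by apply/max_idPl; rewrite sqr_ge0.
- rewrite NE powR_ge0/=.
  have one : 1 `^ 2^-1 = 1 :> R by rewrite powR1.
  rewrite -[leRHS]one; apply: ge0_ler_powR; rewrite ?nnegrE//.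
  by rewrite -lee_fin -fe.
- have [N0|N0] := eqVneq (lpnorm 2 x) 0; last first.
    rewrite /lpnormalize zsumZ; last by rewrite invr_ge0 NE powR_ge0.
    by rewrite mulrC mulfVK.
  rewrite N0 mul0r.
  have e00 : e = 0%E by rewrite fe -N2 N0 expr0n.
  have x00 t : x t = 0.
    have := le_esum_int t (a0 2); rewrite -/e e00 lee_fin => h.
    have /eqP : `|x t| `^ 2 = 0 by apply/eqP; rewrite eq_le h powR_ge0.
    by rewrite powR_eq0 normr_eq0 => /andP[/eqP].
  rewrite /zsum !esum1 ?subrr// => t _; congr _%:E.
    by rewrite /funrneg x00 oppr0 maxxx.
  by rewrite /funrpos x00 maxxx.
Qed.

End SequenceMeasurability.

(** * Change of law by a density *)

Section ChangeOfLaw.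
Context {R : realType} {d d' : measure_display} {T : measurableType d}
  {T' : measurableType d'} (P : probability T R) (P' : probability T' R).
Local Notation mu := (@lebesgue_measure R).
Variables (D W : T -> R) (W' : T' -> R).
Hypothesis mD : measurable_fun [set: T] D.
Hypothesis D0 : forall w, 0 <= D w.
Hypothesis mW : measurable_fun [set: T] W.
Hypothesis mW' : measurable_fun [set: T'] W'.
Hypothesis lawW' : forall B : set R, measurable B ->
  P' [set w | B (W' w)] = (\int[P]_w (D w * \1_B (W w))%:E)%E.

Let layer (x t : R) : \bar R := (if (0 <= t) && (t < x) then 1 else 0)%:E.

Let integral_layer x : 0 <= x -> (\int[mu]_t layer x t = x%:E)%E.
Proof.
move=> x0.
rewrite (_ : (\int[mu]_t _)%E = (\int[mu]_t (\1_(`[0, x[%classic) t)%:E)%E); last first.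
  apply: eq_integral => t _; rewrite /layer indicE mem_setE in_itv /=.
  by case: (_ && _).
rewrite integral_indic// setIT.
transitivity (lebesgue_measure `[0, x[%classic) => //.
rewrite lebesgue_measure_itv/= lte_fin; case: ltrP => h; first by rewrite oppr0 adde0.
by congr _%:E; apply/eqP; rewrite eq_le x0 h.
Qed.

Let mlayer d0 (S : measurableType d0) (f : S -> R) : measurable_fun [set: S] f ->
  measurable_fun [set: S * R] (fun z => layer (f z.1) z.2).
Proof.
move=> mf; apply/measurable_EFinP; apply: measurable_fun_ifT => //.
apply: measurable_and.
  by apply: measurable_fun_ler => //; exact: measurable_cst.
by apply: measurable_fun_ltr => //; apply: (measurableT_comp mf).
Qed.

Let layer_ge0 x t : (0 <= layer x t)%E.
Proof. by rewrite /layer lee_fin; case: ifP. Qed.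

(* Layer cake: [g = \int_0^oo 1_(t < g) dt] reduces the claim to the sets [t < g]. *)
Lemma ge0_integral_change_law (g : R -> R) :
  measurable_fun [set: R] g -> (forall x, 0 <= g x) ->
  (\int[P']_w (g (W' w))%:E = \int[P]_w (D w * g (W w))%:E)%E.
Proof.
move=> mg g0.
transitivity (\int[P']_w \int[mu]_t layer (g (W' w)) t)%E.
  by apply: eq_integral => w _; rewrite integral_layer.
transitivity (\int[mu]_t \int[P']_w layer (g (W' w)) t)%E.
  apply: (@fubini_tonelli _ _ _ _ _ P' mu (fun z : T' * R => layer (g (W' z.1)) z.2)) => //.
  by apply: (mlayer (measurableT_comp mg mW')).
transitivity (\int[P]_w \int[mu]_t ((D w)%:E * layer (g (W w)) t))%E; last first.
  apply: eq_integral => w _; rewrite ge0_integralZl//.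
  - by rewrite integral_layer.
  - apply: (measurable_fun_pair2 (f := fun z : T * R => layer (g (W z.1)) z.2)).
    exact: (mlayer (measurableT_comp mg mW)).
  - by rewrite lee_fin.
transitivity (\int[mu]_t \int[P]_w ((D w)%:E * layer (g (W w)) t))%E; last first.
  apply/esym.
  apply: (@fubini_tonelli _ _ _ _ _ P mu (fun z : T * R => ((D z.1)%:E * layer (g (W z.1)) z.2)%E)).
    apply: emeasurable_funM; first by apply/measurable_EFinP; exact: measurableT_comp.
    exact: (mlayer (measurableT_comp mg mW)).
  by move=> z; rewrite mule_ge0// lee_fin.
apply: eq_integral => t _.
have [t0|t0] := leP 0 t; last first.
  by rewrite /layer leNgt t0/= !integral0_eq// => w _; rewrite ?mule0.
pose B : set R := [set x | t < g x].
have mB : measurable B.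
  have -> : B = g @^-1` `]t, +oo[ by apply/seteqP; split=> x; rewrite /B/= in_itv/= andbT.
  by rewrite -[X in measurable X]setTI; apply: mg.
transitivity (P' [set w | B (W' w)]).
  rewrite (_ : (\int[P']_w _)%E = (\int[P']_w (\1_[set w | B (W' w)] w)%:E)%E); last first.
    apply: eq_integral => w _; rewrite /layer t0/= indicE.
    by case: ifPn => h; [rewrite mem_set|rewrite memNset//; apply/negP].
  rewrite integral_indic ?setIT//.
  by rewrite -[X in measurable X]setTI; apply: mW'.
rewrite lawW'//; apply: eq_integral => w _; rewrite /layer t0/= indicE -EFinM.
by case: ifPn => h; [rewrite mem_set|rewrite memNset//; apply/negP].
Qed.

Lemma integral_change_law (f : R -> R) : measurable_fun [set: R] f ->
  (\int[P']_w (f (W' w))%:E = \int[P]_w (D w * f (W w))%:E)%E.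
Proof.
move=> mf; rewrite [LHS]integralE [RHS]integralE.
have max0 (x y : R) : 0 <= x -> maxe (x * y)%:E 0 = (x * Num.max y 0)%:E.
  by move=> x0; rewrite -EFin_max maxr_pMr// mulr0.
congr (_ - _)%E.
- have := @ge0_integral_change_law (fun x => Num.max (f x) 0).
  rewrite [X in _ -> _ -> X = _](_ : _ = (\int[P']_x ((fun w => (f (W' w))%:E)^\+ x))%E); last first.
    by apply: eq_integral => w _; rewrite funeposE EFin_max.
  move=> ->; last 2 first.
  + by apply: measurable_maxr.
  + by move=> x; rewrite le_max lexx orbT.
  by apply: eq_integral => w _; rewrite funeposE max0.
- have := @ge0_integral_change_law (fun x => Num.max (- f x) 0).
  rewrite [X in _ -> _ -> X = _](_ : _ = (\int[P']_x ((fun w => (f (W' w))%:E)^\- x))%E); last first.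
    by apply: eq_integral => w _; rewrite funenegE EFin_max.
  move=> ->; last 2 first.
  + by apply: measurable_maxr => //; exact: measurableT_comp.
  + by move=> x; rewrite le_max lexx orbT.
  by apply: eq_integral => w _; rewrite funenegE -EFinN -mulrN max0.
Qed.

End ChangeOfLaw.

(** * From the weighted moments to the moment of the ratio *)

Section LaplaceInversion.
Context {R : realType} {d : measure_display} {T : measurableType d}
  (P : probability T R).
Local Notation mu := (@lebesgue_measure R).

Lemma integral_powR_expRN (p b : R) : 0 < p -> 0 < b ->
  (\int[mu]_(x in `]0%R, +oo[) (x `^ (p - 1) * expR (- (x * b)))%:E =
   (Gamma_pos p / b `^ p)%:E)%E.
Proof.
move=> p0 b0; have := @integral_powR_expR_powR R p b 1 p0 b0.
rewrite ltr01 lexx mul1r mul1r => <-//.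
apply: eq_integral => x; rewrite inE/= in_itv/= andbT => x0.
by rewrite powRr1 ?(ltW x0)// [b * x]mulrC.
Qed.

(* [Gamma (n) (xi / zeta)^(2 n) = \int_0^oo x^(n - 1) xi^(2 n) e^(- x zeta^2) dx];
   the event [zeta = 0] is harmless: the right-hand side is infinite there unless
   [xi = 0], in which case both sides vanish. *)
Lemma expectation_ratio_laplace (xi zeta : T -> R) (alpha A : R) (m : nat) (C : nat -> R) :
  measurable_fun [set: T] xi -> measurable_fun [set: T] zeta ->
  1 < alpha < 2 -> 0 < A -> (0 < m)%N -> ~~ odd m ->
  (forall x : R, (0 < x)%R -> \int[P]_w (expR (- (x * zeta w ^+ 2)) * xi w ^+ m)%:E =
    (\sum_(1 <= k < m.+1) C k * x `^ ((k%:R * alpha - m%:R) / 2) * expR (- (A * x `^ (alpha / 2))))%:E)%E ->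
  (\int[P]_w ((xi w / zeta w) ^+ m)%:E =
   ((\sum_(1 <= k < m.+1) C k * ((k.-1)`!%:R * (2 / alpha) / A ^+ k)) / ((m./2).-1)`!%:R)%:E)%E.
Proof.
move=> mxi mzeta /andP[a1 a2] A0 m0 mev hC.
have a0 : 0 < alpha by lra.
pose n := m./2.
have mE : m = (n * 2)%N by rewrite muln2 -[LHS]odd_double_half (negbTE mev).
have n0 : (0 < n)%N by lia.
have nR0 : 0 < n%:R :> R by rewrite ltr0n.
have Gn : Gamma_pos n%:R = n.-1`!%:R :> R by rewrite -{1}(prednK n0) Gamma_posS.
have fn0 : (0 : R) < n.-1`!%:R by rewrite ltr0n fact_gt0.
have xim0 w : 0 <= xi w ^+ m by apply: exprn_even_ge0.
pose ind (x : R) : R := x `^ (n%:R - 1) * \1_(`]0, +oo[%classic) x.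
have ind0 x : 0 <= ind x by rewrite /ind mulr_ge0 ?powR_ge0.
have mind : measurable_fun [set: R] ind.
  by apply: measurable_funM; [exact: measurable_powR|exact: measurable_indic].
pose h (z : R * T) : \bar R := (ind z.1 * (expR (- (z.1 * zeta z.2 ^+ 2)) * xi z.2 ^+ m))%:E.
have h0 z : (0 <= h z)%E by rewrite lee_fin mulr_ge0// mulr_ge0 ?expR_ge0.
have mh : measurable_fun [set: R * T] h.
  apply/measurable_EFinP; apply: measurable_funM; first exact: measurableT_comp.
  apply: measurable_funM.
    apply: measurableT_comp => //; apply: measurableT_comp => //.
    apply: measurable_funM => //; apply: (measurableT_comp (exprn_measurable _)).
    exact: measurableT_comp.
  by apply: (measurableT_comp (exprn_measurable _)); exact: measurableT_comp.
have indE (f : R -> R) : (\int[mu]_x (ind x * f x)%:E =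
    \int[mu]_(x in `]0%R, +oo[) (x `^ (n%:R - 1) * f x)%:E)%E.
  rewrite [RHS]integral_mkcond; apply: eq_integral => y _; rewrite patchE /ind indicE.
  by case: ifPn => yD; rewrite ?(negbTE yD) ?mulr1// mulr0 mul0r.
set v := \sum_(1 <= k < m.+1) _.
have lap : (\int[P]_w \int[mu]_x h (x, w) = v%:E)%E.
  rewrite -(@fubini_tonelli _ _ _ _ _ mu P h mh h0).
  transitivity (\int[mu]_x (ind x * (\sum_(1 <= k < m.+1) C k * x `^ ((k%:R * alpha - m%:R) / 2) *
      expR (- (A * x `^ (alpha / 2)))))%:E)%E.
    apply: eq_integral => x _; rewrite /h /=.
    have [x0|x0] := ltP 0 x; last first.
      have -> : ind x = 0 by rewrite /ind indicE memNset ?mulr0//= in_itv/= andbT; apply/negP; rewrite -leNgt.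
      by rewrite mul0r integral0_eq// => w _; rewrite mul0r.
    under eq_integral do rewrite EFinM.
    rewrite ge0_integralZl//; last 3 first.
    - apply/measurable_EFinP; apply: measurable_funM.
        apply: measurableT_comp => //; apply: measurableT_comp => //.
        by apply: measurable_funM => //; exact: (measurableT_comp (exprn_measurable _)).
      exact: (measurableT_comp (exprn_measurable _)).
    - by move=> w _; rewrite lee_fin mulr_ge0 ?expR_ge0.
    - by rewrite lee_fin.
    by rewrite hC// EFinM.
  rewrite indE.
  (* As [m = n * 2], the powers add up to $n-1+(k\alpha-m)/2 = k\alpha/2-1$, and the substitution $t
     = A x^{\alpha/2}$ gives $\Gamma(k)$. *)
  have Jk k : (0 < k)%N -> (\int[mu]_(x in `]0%R, +oo[)
      (x `^ (alpha / 2 * k%:R - 1) * expR (- (A * x `^ (alpha / 2))))%:E =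
      ((k.-1)`!%:R * (2 / alpha) / A ^+ k)%:E)%E.
    move=> k0; rewrite integral_powR_expR_powR ?ltr0n//; last by apply/andP; split; lra.
    congr _%:E; rewrite -{1}(prednK k0) Gamma_posS powR_mulrn ?(ltW A0)//.
    by field; rewrite !lt0r_neq0// exprn_gt0.
  transitivity (\int[mu]_(x in `]0%R, +oo[) (\sum_(1 <= k < m.+1)
     ((C k)%:E * (x `^ (alpha / 2 * k%:R - 1) * expR (- (A * x `^ (alpha / 2))))%:E)))%E.
    apply: eq_integral => x; rewrite inE/= in_itv/= andbT => x0.
    rewrite mulr_sumr -sumEFin; apply: eq_bigr => k _; rewrite -EFinM; congr _%:E.
    rewrite (_ : alpha / 2 * k%:R - 1 = (n%:R - 1) + (k%:R * alpha - m%:R) / 2); last first.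
      by rewrite mE natrM; field.
    by rewrite [x `^ (n%:R - 1 + _)]powRD_gt0//; ring.
  have ik k : (0 < k)%N -> mu.-integrable `]0%R, +oo[
      (fun x => (x `^ (alpha / 2 * k%:R - 1) * expR (- (A * x `^ (alpha / 2))))%:E).
    move=> k0; apply/integrableP; split.
      apply/measurable_EFinP; apply: measurable_funTS; apply: measurable_powRM_expR.
      by apply: measurableT_comp => //; apply: measurable_funM => //; exact: measurable_powR.
    under eq_integral do rewrite gee0_abs ?lee_fin ?mulr_ge0 ?powR_ge0 ?expR_ge0//.
    by rewrite Jk// ltry.
  under eq_integral do rewrite big_add1/= big_mkord.
  rewrite integral_sum//; last by move=> k; apply: integrableZl => //; exact: ik.
  rewrite -sumEFin /v big_add1/= big_mkord; apply: eq_bigr => k _.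
  by rewrite integralZl//; [rewrite Jk// EFinM|exact: ik].
(* A real power of 0 with nonzero exponent is 0, which agrees with division by 0 when
   [zeta w = 0]. *)
pose G w : R := xi w ^+ m * (zeta w ^+ 2) `^ (- n%:R).
have GE w : (xi w / zeta w) ^+ m = G w.
  rewrite /G powR_invn ?sqr_ge0// -exprM mulnC -mE exprMn exprVn//.
have inner_zeta w : zeta w != 0 -> (\int[mu]_x h (x, w) = (n.-1`!%:R * G w)%:E)%E.
  move=> z0; have z20 : 0 < zeta w ^+ 2 by rewrite exprn_even_gt0.
  rewrite /h /= indE.
  under eq_integral do rewrite mulrA mulrC EFinM.
  rewrite ge0_integralZl//; last 3 first.
  - apply/measurable_EFinP; apply: measurable_funTS; apply: measurable_powRM_expR.
    by apply: measurableT_comp => //; exact: measurable_funM.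
  - by move=> x _; rewrite lee_fin mulr_ge0 ?powR_ge0 ?expR_ge0.
  - by rewrite lee_fin.
  rewrite integral_powR_expRN// Gn -EFinM /G powRN; congr _%:E; ring.
have inner_inf w : zeta w = 0 -> xi w != 0 -> (\int[mu]_x h (x, w) = +oo)%E.
  move=> z0 x0.
  have xp : 0 < xi w ^+ m by rewrite exprn_even_gt0// x0 orbT.
  (* The integrand has no exponential decay here; inserting $e^{-xb} \le 1$ gives a lower bound that
     explodes as [b] tends to 0. With [b <= 1], $b^n$ may be replaced by [b]. *)
  have lb (b : R) : 0 < b <= 1 -> ((xi w ^+ m / b)%:E <= \int[mu]_x h (x, w))%E.
    move=> /andP[b0 b1].
    apply: (@le_trans _ _ (\int[mu]_x (ind x * (expR (- (x * b)) * xi w ^+ m))%:E)%E).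
      rewrite indE; under eq_integral do rewrite mulrA mulrC EFinM.
      rewrite ge0_integralZl//; last 3 first.
      - apply/measurable_EFinP; apply: measurable_funTS; apply: measurable_powRM_expR.
        by apply: measurableT_comp => //; exact: measurable_funM.
      - by move=> x _; rewrite lee_fin mulr_ge0 ?powR_ge0 ?expR_ge0.
      - by rewrite lee_fin.
      rewrite integral_powR_expRN// Gn -EFinM lee_fin ler_wpM2l// powR_mulrn ?(ltW b0)//.
      rewrite -[leLHS]mul1r ler_pM ?invr_ge0 ?(ltW b0)//; first by rewrite ler1n fact_gt0.
      rewrite lef_pV2 ?posrE ?exprn_gt0//.
      by rewrite -[leRHS]expr1 ler_wiXn2l// ltW.
    apply: ge0_le_integral => //.
    - by move=> x _; rewrite lee_fin mulr_ge0// mulr_ge0 ?expR_ge0.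
    - apply/measurable_EFinP; apply: measurable_funM => //; apply: measurable_funM => //.
      by do 2 apply: measurableT_comp => //; exact: measurable_funM.
    - exact: (measurable_fun_pair1 w mh).
    - move=> x _; rewrite /h /= z0 expr0n/= mulr0 oppr0 expR0 lee_fin /ind indicE.
      have [x1|x1] := ltP 0 x; last first.
        by rewrite memNset ?mulr0 ?mul0r//= in_itv/= andbT; apply/negP; rewrite -leNgt.
      rewrite ler_wpM2l ?mulr_ge0 ?powR_ge0//= ler_wpM2r// -expR0 ler_expR oppr_le0.
      by rewrite mulr_ge0// ltW.
  have : (0 <= \int[mu]_x h (x, w))%E by apply: integral_ge0.
  case: (\int[mu]_x h (x, w))%E lb => [r lb r0| |]//.
  (* For a finite value [r] this choice would give $\xi^m \le r\,\xi^m/(r+1)$, impossible as $\xi^m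
     > 0$. *)
  have := lb (Num.min 1 (xi w ^+ m / (r + 1))).
  rewrite lee_fin in r0; have r1 : 0 < r + 1 by rewrite ltr_wpDl.
  rewrite lt_min ltr01 ge_min lexx divr_gt0//= lee_fin.
  move=> /(_ isT); rewrite ler_pdivrMr ?lt_min ?ltr01 ?divr_gt0// => hh.
  have : r * Num.min 1 (xi w ^+ m / (r + 1)) <= r * (xi w ^+ m / (r + 1)).
    by rewrite ler_wpM2l// ge_min lexx orbT.
  move=> /(le_trans hh) hh2; exfalso; move: hh2; rewrite mulrA ler_pdivlMr//.
  by move: xp; set X := xi w ^+ m => xp; nra.
have mI : measurable_fun [set: T] (fun w => \int[mu]_x h (x, w))%E.
  exact: (@measurable_fun_fubini_tonelli_G _ _ _ _ _ mu h mh h0).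
have mG : measurable_fun [set: T] G.
  apply: measurable_funM; first exact: (measurableT_comp (exprn_measurable _)).
  apply: (measurableT_comp (measurable_powR _)).
  exact: (measurableT_comp (exprn_measurable _)).
have iI : P.-integrable setT (fun w => \int[mu]_x h (x, w))%E.
  apply/integrableP; split => //.
  under eq_integral do rewrite gee0_abs ?integral_ge0//.
  by rewrite lap ltry.
have G0 w : 0 <= G w by rewrite mulr_ge0 ?powR_ge0.
(* The double integral is finite, so the inner one is finite almost surely; this excludes
   [zeta w = 0] with [xi w != 0] up to a null set. *)
have aeE : {ae P, forall w, setT w -> (\int[mu]_x h (x, w))%E = (n.-1`!%:R * G w)%:E}.
  apply: filterS (integrable_ae measurableT iI) => w /(_ I) fin _.
  have [z0|z0] := eqVneq (zeta w) 0; last exact: inner_zeta.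
  have [x0|x0] := eqVneq (xi w) 0; last by move: fin; rewrite inner_inf.
  rewrite integral0_eq; last by move=> x _; rewrite /h /= x0 expr0n gtn_eqF// !mulr0.
  by rewrite /G x0 expr0n gtn_eqF// mul0r mulr0.
have : (\int[P]_w (n.-1`!%:R * G w)%:E = v%:E)%E.
  rewrite -lap; apply: ge0_ae_eq_integral => //.
  - by apply/measurable_EFinP; exact: measurable_funM.
  - by move=> w _; rewrite lee_fin mulr_ge0// ltW.
  - by move=> w _; apply: integral_ge0.
  - by apply: filterS aeE => w hw /hw ->.
under eq_integral do rewrite EFinM.
rewrite ge0_integralZl//; last 2 first.
- exact/measurable_EFinP.
- by move=> w _; rewrite lee_fin.
have -> : (\int[P]_w ((xi w / zeta w) ^+ m)%:E = \int[P]_w (G w)%:E)%E.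
  by apply: eq_integral => w _; rewrite GE.
move=> e.
have : ((n.-1`!%:R^-1)%:E * (n.-1`!%:R%:E * \int[P]_w (G w)%:E) = (v / n.-1`!%:R)%:E)%E.
  by rewrite e -EFinM mulrC.
by rewrite muleA -EFinM mulVf ?lt0r_neq0// mul1e.
Qed.

End LaplaceInversion.

Section RecursiveSequence.
Context {F : numFieldType}.

(** Course-of-values recursion: the list [bs n] holds the first [n.+1] coefficients, and by [bsD]
    stored entries never change. *)
Lemma exists_exp_coefficients (a : nat -> F) : exists b : nat -> F,
  b 0%N = 1 /\
  forall n, n.+1%:R * b n.+1 = \sum_(j < n.+1) a j * b (n - j)%N.
Proof.
pose next (s : seq F) : F :=
  (\sum_(j < size s) a j * s`_((size s).-1 - j)) / (size s)%:R.
pose bs n := iter n (fun s => rcons s (next s)) [:: 1].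
have size_bs n : size (bs n) = n.+1.
  by elim: n => //= n IH; rewrite size_rcons IH.
have bsD n k i : (i <= n)%N -> (bs (k + n)%N)`_i = (bs n)`_i.
  move=> i_n; elim: k => //= k IH.
  rewrite nth_rcons size_bs ifT; first exact: IH.
  by rewrite ltnS (leq_trans i_n)// leq_addl.
exists (fun n => (bs n)`_n); split => // n.
rewrite {1}/bs iterS -/(bs n) nth_rcons size_bs ltnn eqxx /next size_bs.
rewrite mulrC mulfVK ?pnatr_eq0//=; apply: eq_bigr => j _.
congr (_ * _); have jn := ltn_ord j.
by have := @bsD (n - j)%N j _ (leqnn _); rewrite subnKC.
Qed.

End RecursiveSequence.

(** * Real form of the limit law *)

Section LimitLaw.
Context {R : realType} {d : measure_display} {T : measurableType d}
  {P : probability T R} {d' : measure_display} {T' : measurableType d'}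
  {P' : probability T' R}.
Local Notation mu := (@lebesgue_measure R).

Lemma expectationE (f : T -> R) : ('E_P[f] = \int[P]_w (f w)%:E)%E.
Proof. by rewrite unlock. Qed.

(** $\mathrm{Re}\,e^{\Psi} = e^{\mathrm{Re}\,\Psi}\cos(\mathrm{Im}\,\Psi)$. The compensator puts 1
    into the real part and $uyS$ into the imaginary part, hence the four values of [cosq]. *)
Lemma limit_law_real_part (alpha : R) (Theta : int -> {RV P >-> R})
    (xi zeta : {RV P' >-> R}) (U W : T -> R) :
  limit_law alpha Theta xi zeta ->
  (forall w, zsum (Qseq alpha Theta w) = U w * W w) ->
  (forall w, zsum (fun t => Qseq alpha Theta w t ^+ 2) = U w ^+ 2) ->
  forall lambda u : R, 0 <= lambda ->
  let psi theta := \int[mu]_(y in `]0, +oo[)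
     ((\int[P]_w (expR (- (lambda * (y * U w) ^+ 2)) * cos (u * (y * U w * W w) + theta)
        - \sum_(j < 2) cosq theta j / j`!%:R * (u * (y * U w * W w)) ^+ j))
      * (alpha * y `^ (- alpha - 1))) in
  \int[P']_w (expR (- (lambda * zeta w ^+ 2)) * cos (u * xi w)) =
    expR (psi 0) * cos (psi (- (pi / 2))).
Proof.
move=> [_ lim] SE VE lambda u l0 psi.
have /(congr1 (@complex.Re R)) := lim u lambda l0.
rewrite /cexpectation /cintegral /cexp /= => ->.
have fact1 : 1`! = 1%N by [].
have c1 : cosq (0 : R) 1 = 0 by rewrite /cosq mul1r add0r cos_pihalf.
have c0 : cosq (0 : R) 0 = 1 by rewrite /cosq mul0r addr0 cos0.
have s0 : cosq (- (pi / 2) : R) 0 = 0 by rewrite /cosq mul0r addr0 cosN cos_pihalf.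
have s1 : cosq (- (pi / 2) : R) 1 = 1 by rewrite /cosq mul1r addNr cos0.
congr (expR _ * cos _); apply: eq_Rintegral => y _ /=.
- rewrite mulr0 subr0; congr (_ * _); apply: eq_Rintegral => w _ /=.
  rewrite SE VE addr0 subr0 !big_ord_recl big_ord0 /= /bump/= !add1n !addr0 c0 c1 expr0 mulr1 fact0 divr1 !mul0r addr0.
  by congr (expR _ * cos _ - _); ring.
- rewrite mulr0 add0r; congr (_ * _); apply: eq_Rintegral => w _ /=.
  rewrite SE VE cosBpihalf !big_ord_recl big_ord0 /= /bump/= !add1n addr0 s0 s1 !mul0r add0r fact1 divr1 expr1 mul1r.
  by rewrite subr0; congr (expR _ * sin _ - _); ring.
Qed.

End LimitLaw.

Section FinalLemmas.
Context {R : realType}.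

Lemma prod_powR_sum (x : R) k (f : 'I_k -> R) : 0 < x ->
  \prod_(j < k) x `^ f j = x `^ (\sum_(j < k) f j).
Proof.
move=> x0; elim: k f => [|k IH] f; first by rewrite !big_ord0 powRr0.
by rewrite !big_ord_recl IH -powRD_gt0.
Qed.

End FinalLemmas.

Theorem proposition5p1 (R : realType) (alpha : R)
  (d : measure_display) (T : measurableType d) (P : probability T R)
  (X : int -> {RV P >-> R})
  (d1 : measure_display) (T1 : measurableType d1) (P1 : probability T1 R)
  (Y : {RV P1 >-> R}) (Theta : int -> {RV P1 >-> R})
  (a : nat -> R) (r : nat -> nat)
  (d2 : measure_display) (T2 : measurableType d2) (P2 : probability T2 R)
  (Q2 : int -> {RV P2 >-> R})
  (d3 : measure_display) (T3 : measurableType d3) (P3 : probability T3 R)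
  (xi zeta : {RV P3 >-> R}) (m : nat) :
  1 < alpha < 2 ->
  strictly_stationary X ->
  regularly_varying X alpha Y Theta ->
  ('E_P[X 0%R] = 0)%E ->
  normalizing X a ->
  block_sizes r ->
  mixing X a r ->
  anti_clustering X a r ->
  limit_law alpha Theta xi zeta ->
  Q2_law alpha Theta Q2 ->
  (0 < m)%N -> ~~ odd m ->
  ('E_P2[fun w => (W2 Q2 w ^+ m)%R] < +oo)%E ->
  'E_P3[fun w => ((xi w / zeta w) ^+ m)%R]%E =
  ((m.-1)`!%:R / ((m./2).-1)`!%:R *
   \sum_(1 <= k < m.+1)
    \sum_(l : {ffun 'I_k -> 'I_m.+1} | (\sum_(j < k) l j == m - k)%N)
      (k.-1)`!%:R * (2 / alpha) * ((alpha / 2) / Gamma (1 - alpha / 2)) ^+ k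
      * (\prod_(j < k)
           (Gamma (((l j)%:R + 1 - alpha) / 2)
            / ((l j)`!%:R
               * (maxn 1 (m - j.+1 - \sum_(i < k | (i <= j)%N) l i))%:R)))
      * (\prod_(j < k) fine 'E_P2[fun w => (W2 Q2 w ^+ (l j).+1)%R]))%:E.
Proof.
move=> a12 _ _ _ _ _ _ _ lim Q2law m0 mev EWm.
have /andP[a1 a2] := a12; have a0 : 0 < alpha by lra.
have m1 : (1 < m)%N by case: m m0 mev {EWm} => [|[|]].
pose qs w : g_sigma_algebraType (@seq_cylinder R) := Qseq alpha Theta w.
have mqs : measurable_fun [set: T1] qs.
  apply: (measurableT_comp (@measurable_lpnormalize R alpha)).
  by apply: measurable_to_seqspace => t; exact: measurable_funPT.
pose U w := lpnorm 2 (Qseq alpha Theta w).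
pose W w := zsum (lpnormalize 2 (Qseq alpha Theta w)).
have mU : measurable_fun [set: T1] U.
  exact: (measurableT_comp (@measurable_lpnorm R 2) mqs).
have mW : measurable_fun [set: T1] W.
  exact: (measurableT_comp (@measurable_zsum R) (measurableT_comp (@measurable_lpnormalize R 2) mqs)).
have UW w : [/\ zsum (fun t => Qseq alpha Theta w t ^+ 2) = U w ^+ 2, 0 <= U w <= 1 &
    zsum (Qseq alpha Theta w) = U w * W w].
  by apply: (@lpnorm2_le1 R alpha); [rewrite a0 ltW|exact: esum_lpnormalize_le1].
have U01 w : 0 <= U w <= 1 by case: (UW w).
have mW2 : measurable_fun [set: T2] (W2 Q2).
  apply: (measurableT_comp (@measurable_zsum R)).
  by apply: measurable_to_seqspace => t; exact: measurable_funPT.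
have [c cE Q2lawE] : exists2 c, c = fine (\int[P1]_w (U w `^ alpha)%:E)%E &
    forall B, seq_measurable B -> P2 [set w | B (Q2 ^~ w)] =
      (\int[P1]_w (U w `^ alpha / c * \1_B (lpnormalize 2 (Qseq alpha Theta w)))%:E)%E.
  exists (fine (\int[P1]_w (U w `^ alpha)%:E)%E) => // B mB.
  by rewrite Q2law// !expectationE.
have mUa : measurable_fun [set: T1] (fun w => U w `^ alpha).
  exact: (measurableT_comp (measurable_powR _)).
pose D w := U w `^ alpha / c.
have mD : measurable_fun [set: T1] D by exact: measurable_funM.
have c_ge0 : 0 <= c.
  by rewrite cE fine_ge0// integral_ge0// => w _; rewrite lee_fin powR_ge0.
have c_neq0 : c != 0.
  (* With [c = 0] the density would be 0 and the whole space would have mass 0. *)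
  apply/eqP => c0; have := Q2lawE setT (@measurableT _ (g_sigma_algebraType (@seq_cylinder R))).
  rewrite (_ : [set w | _] = setT)// probability_setT integral0_eq.
    by move/eqP; rewrite eqe oner_eq0.
  by move=> w _; rewrite c0 invr0 mulr0 mul0r.
have c0 : 0 < c by rewrite lt_neqAle eq_sym c_neq0.
have D0 w : 0 <= D w by rewrite divr_ge0 ?powR_ge0.
have lawW2 (B : set R) : measurable B ->
    P2 [set w | B (W2 Q2 w)] = (\int[P1]_w (D w * \1_B (W w))%:E)%E.
  move=> mB; have := Q2lawE [set x | B (zsum x)]; apply.
  by have := @measurable_zsum R measurableT B mB; rewrite setTI.
have law f := @integral_change_law R _ _ T1 T2 P1 P2 D W (W2 Q2) mD D0 mW mW2 lawW2 f.
(* As [m] is even, $W^m$ is nonnegative, so the assumed finite moment of [W2] is absolute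
   integrability under the density [D]. *)
have iDW : P1.-integrable setT (fun w => (D w * W w ^+ m)%:E).
  apply/integrableP; split.
    apply/measurable_EFinP; apply: measurable_funM => //.
    exact: (measurableT_comp (exprn_measurable _)).
  rewrite (_ : (\int[P1]_x _)%E = (\int[P2]_w (W2 Q2 w ^+ m)%:E)%E); first by rewrite -expectationE.
  rewrite (law (fun x => x ^+ m)); last exact: exprn_measurable.
  by apply: eq_integral => w _; rewrite gee0_abs// lee_fin mulr_ge0// exprn_even_ge0.
have iW : P1.-integrable setT (fun w => (U w `^ alpha * `|W w| ^+ m)%:E).
  rewrite (_ : (fun w => _) = (fun w => c%:E * (D w * W w ^+ m)%:E)%E).
    exact: integrableZl.
  apply/funext => w; rewrite -EFinM -normrX ger0_norm ?exprn_even_ge0//; congr _%:E.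
  by rewrite /D; field.
pose M j := fine 'E_P2[fun w => (W2 Q2 w ^+ j)%R]%E.
have momE j : (j <= m)%N -> \int[P1]_w (U w `^ alpha * W w ^+ j) = c * M j.
  move=> jm; rewrite /M expectationE (law (fun x => x ^+ j)); last exact: exprn_measurable.
  have iDj : P1.-integrable setT (EFin \o (fun w => D w * W w ^+ j)).
    rewrite (_ : _ \o _ = (fun w => c^-1%:E * (U w `^ alpha * W w ^+ j)%:E)%E).
      apply: integrableZl => //.
      exact: (@integrable_powR_moment R _ T1 P1 U W alpha m mU mW U01 a12 iW).
    by apply/funext => w /=; rewrite -EFinM; congr _%:E; rewrite /D; ring.
  rewrite -/(Rintegral P1 setT (fun w => D w * W w ^+ j)) -RintegralZl//.
  by apply: eq_Rintegral => w _; rewrite /D; field.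
(* $-A x^{\alpha/2}$ is the coefficient of order 0 of the exponent, because
   $(\alpha/2)\,\Gamma(-\alpha/2) = -\Gamma(1-\alpha/2)$. *)
pose A := c * Gamma (1 - alpha / 2).
have G0 : 0 < Gamma (1 - alpha / 2) by rewrite Gamma_gt0E ?Gamma_pos_gt0//; lra.
have A0 : 0 < A by rewrite mulr_gt0.
(* The coefficient of order [j] of the exponent, without $1/j!$ and without its power of [x]. *)
pose kap0 j : R := alpha / 2 * Gamma ((j%:R - alpha) / 2) * (c * M j).
pose C k : R := m.-1`!%:R * \sum_(l : {ffun 'I_k -> 'I_m.+1} | (\sum_(j < k) l j == m - k)%N)
  \prod_(j < k) (kap0 (l j).+1 / ((l j)`!%:R *
     (maxn 1 (m - j.+1 - \sum_(i < k | (i <= j)%N) l i))%:R)).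
(* It keeps the orders $l_j + 1$ of the moments at most [m], the range in which [momE] applies. *)
have lj_lt k (l : {ffun 'I_k -> 'I_m.+1}) j : (0 < k)%N ->
    (\sum_(j < k) l j)%N = (m - k)%N -> (l j < m)%N.
  move=> k0 h; have : (l j <= \sum_(j < k) l j)%N by rewrite (bigD1 j)//= leq_addr.
  by rewrite h; lia.
have hC (x : R) : (0 < x)%R -> (\int[P3]_w (expR (- (x * zeta w ^+ 2)) * xi w ^+ m)%:E =
    (\sum_(1 <= k < m.+1) C k * x `^ ((k%:R * alpha - m%:R) / 2) * expR (- (A * x `^ (alpha / 2))))%:E)%E.
  move=> x0.
  pose kap j := comp_moment alpha x j * \int[P1]_w (U w `^ alpha * W w ^+ j).
  (* With $a_j = \kappa_j/j!$, the term $\kappa_{j+1}/j!$ is $(j+1)\,a_{j+1}$. *)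
  have [b [b0 brec]] := @exists_exp_coefficients R (fun j => kap j.+1 / j`!%:R).
  have := @integral_transform_moment R _ T1 P1 _ T3 P3 U W xi zeta alpha x m b mU mW
    (measurable_funPT xi) (measurable_funPT zeta) U01 a12 x0 m1 mev iW.
  have SE w : zsum (Qseq alpha Theta w) = U w * W w by case: (UW w).
  have VE w : zsum (fun t => Qseq alpha Theta w t ^+ 2) = U w ^+ 2 by case: (UW w).
  have psiE u := limit_law_real_part lim SE VE u (ltW x0).
  move=> /(_ psiE b0) -> //; last first.
    move=> n nm; rewrite brec; apply: eq_bigr => j _; congr (_ * _).
    rewrite -/(kap j.+1) factS natrM; field.
    by rewrite nat1r !pnatr_eq0 -lt0n fact_gt0.
  rewrite -/(kap 0%N) fact0 divr1 (@sum_compositions_unroll R kap m.+1 b m); last 3 first.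
  - by rewrite m0 ltnS leqnn.
  - by [].
  - by move=> n _; exact: brec.
  congr _%:E.
  have -> : kap 0%N = - (A * x `^ (alpha / 2)).
    have M0 : M 0%N = 1.
      by rewrite /M (_ : (fun w => _) = cst 1) ?expectation_cst//; apply/funext.
    rewrite /kap /comp_moment momE// M0 mulr1.
    rewrite Gamma_itvN10; last by rewrite sub0r; apply/andP; split; lra.
    rewrite /A Gamma_gt0E; last by lra.
    rewrite (_ : (0 - alpha) / 2 + 1 = 1 - alpha / 2); last by field.
    rewrite (_ : (alpha - 0) / 2 = alpha / 2); last by field.
    by rewrite sub0r; field; rewrite ?oppr_eq0 lt0r_neq0.
  rewrite mulrCA mulr_sumr mulr_sumr; apply: eq_big_nat => k /andP[k0 km].
  rewrite [expR _ * _]mulrC mulrA; congr (_ * expR _); rewrite /C -mulrA; congr (_ * _).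
  rewrite mulr_suml; apply: eq_bigr => l /eqP hl.
  (* The powers of [x] of the [k] coefficients combine into one because $\sum_j l_j = m-k$. *)
  rewrite -(_ : \sum_(j < k) (alpha - (l j).+1%:R) / 2 = (k%:R * alpha - m%:R) / 2); last first.
    rewrite -mulr_suml sumrB sumr_const card_ord; congr ((_ - _) / _).
      by rewrite mulr_natl.
    rewrite -natr_sum; congr _%:R.
    under eq_bigr do rewrite -addn1.
    by rewrite big_split/= hl sum1_card card_ord subnK// -ltnS.
  rewrite -prod_powR_sum// -big_split; apply: eq_bigr => j _ /=.
  by rewrite /kap /kap0 /comp_moment momE; [ring|exact: lj_lt hl].
rewrite expectationE (@expectation_ratio_laplace R _ T3 P3 xi zeta alpha A m C (measurable_funPT xi) (measurable_funPT zeta) a12 A0 m0 mev hC).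
congr _%:E; rewrite mulr_suml mulr_sumr; apply: eq_big_nat => k /andP[k0 km].
rewrite /C !mulr_sumr !mulr_suml; apply: eq_bigr => l /eqP hl.
(* Each factor carries one [c], and $A^k$ in the denominator carries [k] of them: they cancel and
   leave $((\alpha/2)/\Gamma(1-\alpha/2))^k$. *)
have -> : \prod_(j < k) (kap0 (l j).+1 / ((l j)`!%:R *
     (maxn 1 (m - j.+1 - \sum_(i < k | (i <= j)%N) l i))%:R)) =
   (alpha / 2 * c) ^+ k * (\prod_(j < k) (Gamma (((l j)%:R + 1 - alpha) / 2)
            / ((l j)`!%:R
               * (maxn 1 (m - j.+1 - \sum_(i < k | (i <= j)%N) l i))%:R)))
      * (\prod_(j < k) fine 'E_P2[fun w => (W2 Q2 w ^+ (l j).+1)%R]%E).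
  rewrite -[in (_ * c) ^+ k](card_ord k) -prodr_const -!big_split; apply: eq_bigr => j _ /=.
  by rewrite /kap0 -/(M _) natr1; ring.
rewrite /A; move: G0; move: (Gamma (1 - alpha / 2)) => g G0; set p1 := \prod_(j < k) _; set p2 := \prod_(j < k) _.
rewrite !exprMn !exprVn.
have ck : c ^+ k != 0 by rewrite expf_neq0.
have gk : g ^+ k != 0 by rewrite expf_neq0// lt0r_neq0.
have tk : (2 : R) ^+ k != 0 by rewrite expf_neq0.
have fm : ((m./2).-1)`!%:R != 0 :> R by rewrite pnatr_eq0 -lt0n fact_gt0.
by field; rewrite ck gk tk fm lt0r_neq0.
Qed.
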